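(* Let $T_1$ and $T_2$ be countable weakly $2$-transitive trees (each with all maximal chains isomorphic to $\mathbb{Q}$ and with incomparable points) such that all maximal chains of $T_1^+$ and of $T_2^+$ are dense, and suppose that $T_1$ and $T_2$ have distinct infinite codes. Then $|U_{T_1}|$ (in $\mathfrak{N}_{T_1}$) and $|U_{T_2}|$ (in $\mathfrak{N}_{T_2}$) are $\equiv$-inequivalent members of $\Delta_5\setminus\Delta_4$.
   Context: Cardinal classes. $\Delta_4$ is the class of cardinalities of sets $X$ having no surjection onto $\omega$. $\Delta_5$ is the class of cardinalities of sets $X$ having no surjection to a proper superset of $X$ (equivalently, every surjection $X\to X$ is injective). Trees. A tree is a partially ordered set $(T,\le)$ in which any two elements have a common lower bound and $\{y\in T:y\le x\}$ is linearly ordered for every $x\in T$. A tree is weakly $2$-transitive if for any two $2$-element chains there is an automorphism of $T$ taking the first to the second. Non-triviality is assumed throughout: all maximal chains of $T$ are isomorphic to $\mathbb{Q}$, and there are incomparable points. $T^+$ is the least lower semilattice (tree in which any two elements have a greatest lower bound, or meet, $\wedge$) extending $T$; it is obtained from $T$ by adjoining points so that any two members of $T$ have a meet, and all new points have the form $a\wedge b$ with $a,b\in T$. A ramification point is a member of $T^+$ which is the meet of two incomparable members of $T$. At a ramification point $x$ there is an equivalence relation on the points above $x$: $y\sim z$ if for some $t>x$, $y,z\ge t$. The equivalence classes are the cones at $x$, and the number of cones is the ramification order of $x$ (an element of $\{2,3,\ldots,\infty\}$). A ramification point is special if at least one of its cones has a least element; the hypothesis that the maximal chains of $T^+$ are dense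 corresponds to there being no special ramification points. Codes. For a countable weakly $2$-transitive tree $T$ with no special ramification points, the code of $T$ consists of the subset of $\{2,3,\ldots,\infty\}$ of ramification orders which arise, together with the ramification order of the points of $T$ themselves (which is $1$ if points of $T$ do not ramify, and otherwise the common member of $\{2,3,\ldots,\infty\}$ that is their ramification order). The code is infinite if this subset is infinite. Fraenkel--Mostowski models. FMC is ZFC modified to allow a set $U$ of atoms (objects with no elements, distinct from $\emptyset$), with extensionality restricted to non-atoms. Given a ground model $\mathfrak{M}$ of FMC with set of atoms $U$ and a group $G\in\mathfrak{M}$ of permutations of $U$, let $G$ act on $\mathfrak{M}$ by $g(x)=\{g(y):y\in x\}$; write $G_{\{x\}}=\{g\in G:g(x)=x\}$ and $G_x=\{g\in G: g(y)=y \text{ for all } y\in x\}$. The finite support filter $\mathfrak{F}$ is the family of subgroups of $G$ containing $G_A$ for some finite $A\subseteq U$, and the model determined by $G$ with finite supports is $\mathfrak{N}=\{x\in\mathfrak{M}: G_{\{x\}}\in\mathfrak{F}\wedge x\subseteq\mathfrak{N}\}$ (defined by transfinite induction). For a tree $T$, the ground model has set of atoms $U_T=\{u_t:t\in T\}$ indexed by $T$, $G$ is the group of permutations of $U_T$ induced by the automorphism group of $T$, and $\mathfrak{N}_T$ is the resulting model with finite supports. Equivalence. Sets $X$ and $Y$ are equivalent, $X\equiv Y$, if for any first-order structure in a countable language with domain $X$ there is an elementarily equivalent first-order structure with domain $Y$, and vice versa. Here, for $X=U_{T_1}$ and $Y=U_{T_2}$, structures with domain $U_{T_i}$ are those lying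 in $\mathfrak{N}_{T_i}$. *)

(* Defs.v *)
From HB Require Import structures.
From mathcomp Require Import all_boot all_order all_algebra.
From mathcomp Require Import boolp classical_sets functions cardinality.

Set Implicit Arguments.
Unset Strict Implicit.
Unset Printing Implicit Defensive.

Import Order.TTheory.

Local Open Scope classical_set_scope.
Local Open Scope order_scope.

(** * Trees *)

Definition is_tree {d} (T : porderType d) : Prop :=
  (forall x y : T, exists z, z <= x /\ z <= y) /\
  (forall x y z : T, y <= x -> z <= x -> y >=< z).

Definition is_automorphism {d} {T : porderType d} (g : T -> T) : Prop :=
  bijective g /\ {mono g : x y / x <= y}.

Definition weakly_2_transitive {d} (T : porderType d) : Prop :=
  forall a b c e : T, a < b -> c < e ->
    exists g : T -> T, [/\ is_automorphism g, g a = c & g b = e].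

Definition is_chain {d} {T : porderType d} (C : set T) : Prop :=
  forall x y, C x -> C y -> x >=< y.

Definition is_maximal_chain {d} {T : porderType d} (C : set T) : Prop :=
  is_chain C /\ forall D : set T, is_chain D -> C `<=` D -> D = C.

Definition chain_isomorphic_to_Q {d} {T : porderType d} (C : set T) : Prop :=
  exists f : rat -> T, {mono f : x y / x <= y} /\ range f = C.

Definition nontrivial_tree {d} (T : porderType d) : Prop :=
  (forall C : set T, is_maximal_chain C -> chain_isomorphic_to_Q C) /\
  (exists a b : T, a >< b).

Definition dense_chain {d} {T : porderType d} (C : set T) : Prop :=
  forall x y, C x -> C y -> x < y -> exists z, [/\ C z, x < z & z < y].

Definition maximal_chains_dense {d} (T : porderType d) : Prop :=
  forall C : set T, is_maximal_chain C -> dense_chain C.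

(** * The least lower semilattice T^+ extending T *)

(* The meet of a and b is realised as the cut of their common lower bounds,
   i.e. as their infimum in the Dedekind-MacNeille completion of T; a point t of
   T is identified with its principal down-set, which is the cut of (t, t). *)
Definition common_lower {d} {T : porderType d} (a b : T) : set T :=
  [set x | x <= a /\ x <= b].

Definition tplus {d} (T : porderType d) : Type :=
  {D : set T | exists a b, D = common_lower a b}.

Definition lower {d} {T : porderType d} (x : tplus T) : set T := proj1_sig x.

Definition tmeet {d} {T : porderType d} (a b : T) : tplus T :=
  exist _ (common_lower a b) (ex_intro _ a (ex_intro _ b erefl)).

Definition tembed {d} {T : porderType d} (t : T) : tplus T := tmeet t t.

Definition tplus_le {d} {T : porderType d} (x y : tplus T) : bool :=
  `[< lower x `<=` lower y >].

Lemma tplus_le_refl {d} {T : porderType d} : reflexive (@tplus_le d T).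
Proof. by move=> x; apply/asboolP. Qed.

Lemma tplus_le_anti {d} {T : porderType d} : antisymmetric (@tplus_le d T).
Proof.
move=> [x px] [y py] /andP[/asboolP xy /asboolP yx].
by apply: eq_exist; rewrite eqEsubset.
Qed.

Lemma tplus_le_trans {d} {T : porderType d} : transitive (@tplus_le d T).
Proof.
move=> y x z /asboolP xy /asboolP yz.
by apply/asboolP; exact: subset_trans yz.
Qed.

HB.instance Definition _ d (T : porderType d) := gen_eqMixin (tplus T).
HB.instance Definition _ d (T : porderType d) := gen_choiceMixin (tplus T).
HB.instance Definition _ d (T : porderType d) :=
  Order.Le_isPOrder.Build d (tplus T)
    tplus_le_refl tplus_le_anti tplus_le_trans.

Lemma tembed_mono {d} {T : porderType d} :
  {mono (@tembed d T) : x y / x <= y}.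
Proof.
move=> x y; apply/asboolP/idP => [h | xy z [zx _]].
  by have [] := h x (conj (lexx x) (lexx x)).
by split; exact: le_trans xy.
Qed.

Lemma tmeet_glb {d} {T : porderType d} (a b : T) (x : tplus T) :
  (x <= tmeet a b) = (x <= tembed a) && (x <= tembed b).
Proof.
apply/asboolP/andP => [h | [/asboolP ha /asboolP hb]].
  by split; apply/asboolP => z /h [].
by move=> z xz; split; [case: (ha z xz) | case: (hb z xz)].
Qed.

Lemma tmeet_unique {d} {T : porderType d} (a b c : T) :
  (forall x, (x <= c) = (x <= a) && (x <= b)) -> tmeet a b = tembed c.
Proof.
move=> h; apply: eq_exist; rewrite eqEsubset; split=> x /=.
  by case=> xa xb; split; rewrite h xa xb.
by case; rewrite h => /andP[].
Qed.

(** * Ramification orders and codes *)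

Definition ramification_point {d} {T : porderType d} (x : tplus T) : Prop :=
  exists a b : T, a >< b /\ x = tmeet a b.

Definition same_cone {d} {T : porderType d} (x y z : tplus T) : Prop :=
  exists t : tplus T, [/\ x < t, t <= y & t <= z].

Definition cones {d} {T : porderType d} (x : tplus T) : set (set (tplus T)) :=
  [set K | exists y, x < y /\ K = [set z | x < z /\ same_cone x y z]].

(* [Some n] is the finite number n and [None] is infinity. *)
Definition ram_number : Type := option nat.

Definition has_ramification_order {d} {T : porderType d}
    (x : tplus T) (o : ram_number) : Prop :=
  match o with
  | Some n => (cones x #= `I_n)%card
  | None => infinite_set (cones x)
  end.

Definition ramification_orders {d} (T : porderType d) : set ram_number :=
  [set o | exists x : tplus T, ramification_point x /\ has_ramification_order x o].

Definition points_ramification_order {d} (T : porderType d)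
    (o : ram_number) : Prop :=
  (o = Some 1%N /\ forall t : T, ~ ramification_point (tembed t)) \/
  (forall t : T,
     ramification_point (tembed t) /\ has_ramification_order (tembed t) o).

Definition tree_code : Type := (set ram_number * ram_number)%type.

Definition is_code {d} (T : porderType d) (c : tree_code) : Prop :=
  c.1 = ramification_orders T /\ points_ramification_order T c.2.

Definition infinite_code (c : tree_code) : Prop := infinite_set c.1.

(** * The cumulative hierarchy over a set of atoms *)

(* Well-founded sets over the atoms [atom a], taken up to the extensional
   equality [fm_eq]; [coll J F] is the set whose elements are the [F j]. *)
Inductive fm (A : Type) : Type :=
| atom (a : A)
| coll (J : Type) (F : J -> fm A).
Arguments coll {A} J F.

Fixpoint fm_eq {A} (x y : fm A) {struct x} : Prop :=
  match x, y with
  | atom a, atom b => a = b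
  | coll J F, coll K H =>
      (forall j : J, exists k : K, fm_eq (F j) (H k)) /\
      (forall k : K, exists j : J, fm_eq (F j) (H k))
  | _, _ => False
  end.

Definition fm_in {A} (x y : fm A) : Prop :=
  match y with
  | atom _ => False
  | coll J F => exists j : J, fm_eq x (F j)
  end.

Definition fm_is_set {A} (x : fm A) : Prop :=
  match x with atom _ => False | coll _ _ => True end.

Definition fm_sub {A} (x y : fm A) : Prop :=
  forall z, fm_in z x -> fm_in z y.

Definition fm_proper_superset {A} (y x : fm A) : Prop :=
  [/\ fm_is_set y, fm_sub x y & exists z, fm_in z y /\ ~ fm_in z x].

Definition fm_pair {A} (x y : fm A) : fm A :=
  coll bool (fun b => if b then x else y).

Definition fm_opair {A} (x y : fm A) : fm A :=
  fm_pair (fm_pair x x) (fm_pair x y).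

Definition fm_empty {A} : fm A := coll void (of_void _).

Definition fm_succ {A} (x : fm A) : fm A :=
  match x with
  | atom _ => x
  | coll J F => coll (option J) (fun o => if o is Some j then F j else x)
  end.

Definition fm_nat {A} (n : nat) : fm A := iter n fm_succ fm_empty.

Definition fm_omega {A} : fm A := coll nat fm_nat.

Definition fm_atoms (A : Type) : fm A := coll A (@atom A).

Definition fm_function {A} (f X Y : fm A) : Prop :=
  [/\ fm_is_set f,
      forall p, fm_in p f ->
        exists x y, [/\ fm_in x X, fm_in y Y & fm_eq p (fm_opair x y)]
    & forall x, fm_in x X ->
        exists y, fm_in (fm_opair x y) f /\
          forall y', fm_in (fm_opair x y') f -> fm_eq y' y].

Definition fm_surjection {A} (f X Y : fm A) : Prop :=
  fm_function f X Y /\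
  forall y, fm_in y Y -> exists x, fm_in x X /\ fm_in (fm_opair x y) f.

(** * Fraenkel-Mostowski models with finite supports *)

Fixpoint fm_act {A} (g : A -> A) (x : fm A) : fm A :=
  match x with
  | atom a => atom (g a)
  | coll J F => coll J (fun j => fm_act g (F j))
  end.

Definition is_subgroup {A} (G H : set (A -> A)) : Prop :=
  [/\ H `<=` G, H id, forall g h, H g -> H h -> H (g \o h)
    & forall g h, H g -> cancel g h -> cancel h g -> H h].

Definition set_stabilizer {A} (G : set (A -> A)) (x : fm A) : set (A -> A) :=
  [set g | G g /\ fm_eq (fm_act g x) x].

Definition pointwise_stabilizer {A} (G : set (A -> A)) (B : set A) :
    set (A -> A) :=
  [set g | G g /\ forall a, B a -> g a = a].

Definition finite_support_filter {A} (G : set (A -> A)) :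
    set (set (A -> A)) :=
  [set H | is_subgroup G H /\
     exists B : set A, finite_set B /\ pointwise_stabilizer G B `<=` H].

Fixpoint fm_model {A} (G : set (A -> A)) (x : fm A) : Prop :=
  finite_support_filter G (set_stabilizer G x) /\
  match x with
  | atom _ => True
  | coll J F => forall j : J, fm_model G (F j)
  end.

Definition tree_model {d} (T : porderType d) : fm T -> Prop :=
  fm_model (@is_automorphism d T).
Arguments tree_model {d} T _.

(** * The classes Delta_4 and Delta_5, relative to a transitive model N *)

(* Both properties are invariant under equinumerosity in N, so the classes of
   cardinals are given by the sets X whose cardinality belongs to them. *)
Definition Delta4 {A} (N : fm A -> Prop) (X : fm A) : Prop :=
  [/\ N X, fm_is_set X & ~ exists f, N f /\ fm_surjection f X fm_omega].

Definition Delta5 {A} (N : fm A -> Prop) (X : fm A) : Prop :=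
  [/\ N X, fm_is_set X
    & ~ exists Y f,
        [/\ N Y, N f, fm_proper_superset Y X & fm_surjection f X Y]].

(** * First-order logic over countable languages *)

Record language : Type := Language {
  fun_symbol : countType;
  fun_arity : fun_symbol -> nat;
  rel_symbol : countType;
  rel_arity : rel_symbol -> nat }.
Arguments fun_arity {l} _.
Arguments rel_arity {l} _.

Inductive term (L : language) (n : nat) : Type :=
| Var (i : 'I_n)
| App (f : fun_symbol L) (ts : 'I_(fun_arity f) -> term L n).

(* [formula L n] has its free variables among n; [FAll] binds variable 0. *)
Inductive formula (L : language) : nat -> Type :=
| FFalse n : formula L n
| FEq n (t u : term L n) : formula L n
| FRel n (r : rel_symbol L) (ts : 'I_(rel_arity r) -> term L n) : formula L n
| FImp n (p q : formula L n) : formula L n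
| FAll n (p : formula L n.+1) : formula L n.

Definition sentence (L : language) : Type := formula L 0.

Record structure (L : language) (D : Type) : Type := Structure {
  fun_interp : forall f : fun_symbol L, (fun_arity f).-tuple D -> D;
  rel_interp : forall r : rel_symbol L, (rel_arity r).-tuple D -> Prop }.

Fixpoint eval {L D} (S : structure L D) {n} (e : n.-tuple D) (t : term L n) : D :=
  match t with
  | Var i => tnth e i
  | App f ts => @fun_interp L D S f [tuple eval S e (ts i) | i < fun_arity f]
  end.

Fixpoint sat {L D} (S : structure L D) {n} (p : formula L n) :
    n.-tuple D -> Prop :=
  match p in formula _ m return m.-tuple D -> Prop with
  | FFalse _ => fun _ => False
  | FEq _ t u => fun e => eval S e t = eval S e u
  | FRel _ r ts => fun e =>
      @rel_interp L D S r [tuple eval S e (ts i) | i < rel_arity r]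
  | FImp _ q1 q2 => fun e => sat S q1 e -> sat S q2 e
  | FAll _ q => fun e => forall x : D, sat S q (cons_tuple x e)
  end.

Definition elementarily_equivalent {L D1 D2}
    (S1 : structure L D1) (S2 : structure L D2) : Prop :=
  forall p : sentence L, sat S1 p [tuple] <-> sat S2 p [tuple].

(** * Structures on the set of atoms, as elements of the hierarchy *)

Definition fm_tuple {A} (s : seq A) : fm A :=
  foldr (fun a x => fm_opair (atom a) x) fm_empty s.

Definition fm_fun_graph {A n} (h : n.-tuple A -> A) : fm A :=
  coll (n.-tuple A) (fun s => fm_opair (fm_tuple s) (atom (h s))).

Definition fm_relation {A n} (R : n.-tuple A -> Prop) : fm A :=
  coll {s : n.-tuple A | R s} (fun s => fm_tuple (proj1_sig s)).

(* The triple (U, F, R) of the domain U and the maps F, R sending (the numeral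
   coding) a symbol to its interpretation. *)
Definition fm_structure {L A} (S : structure L A) : fm A :=
  fm_opair (fm_atoms A)
    (fm_opair
       (coll (fun_symbol L) (fun f =>
          fm_opair (fm_nat (pickle f)) (fm_fun_graph (@fun_interp L A S f))))
       (coll (rel_symbol L) (fun r =>
          fm_opair (fm_nat (pickle r)) (fm_relation (@rel_interp L A S r))))).

(* The structures with domain the set of atoms that lie in N are, via
   [fm_structure], the structures S on the index set A with N (fm_structure S). *)
Definition structures_transfer {A B} (N : fm A -> Prop) (N' : fm B -> Prop) :
    Prop :=
  forall (L : language) (S : structure L A), N (fm_structure S) ->
    exists S' : structure L B,
      N' (fm_structure S') /\ elementarily_equivalent S S'.

Definition atoms_equivalent {A B} (N : fm A -> Prop) (N' : fm B -> Prop) :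
    Prop :=
  structures_transfer N N' /\ structures_transfer N' N.

(* Main.v *)
Require Import Defs.
From HB Require Import structures.
From mathcomp Require Import all_boot all_order all_algebra.
From mathcomp Require Import boolp classical_sets functions cardinality.

Set Implicit Arguments.
Unset Strict Implicit.
Unset Printing Implicit Defensive.

Import Order.TTheory.

Local Open Scope classical_set_scope.
Local Open Scope order_scope.

(** Write [T] for either tree, and work with supports: an element of the model
    is fixed by all automorphisms that fix a finite set [A] of points.  The
    only automorphisms needed are those given by weak 2-transitivity, cut and
    pasted: two automorphisms that agree at [s] can be glued along the set of
    points above [s] ([automorphism_glue]).

    Gluing moves any [s] while fixing a given finite set [B], unless [s] is in
    [B] or is the meet of two members of [B]
    ([fixed_point_in_meet_closure]).  A function on the atoms with support [B]
    therefore sends [t] to [t], to one of finitely many points attached to [B],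
    or to a meet of [t] with a member of [B].  If it is onto, each point
    outside the finite set attached to [B] has no preimage but itself, and what
    remains is a surjection of a finite set onto itself; nothing is left over
    to cover a new element of a proper superset ([partial_surjection_total]).
    This gives membership in Delta_5.  On the other hand, the ramification
    order of the meet with a fixed point [t0] is a function of support [t0]
    which takes infinitely many values when the code is infinite, so the atoms
    map onto omega and are not in Delta_4.

    For inequivalence, equip the first tree with its order and with the
    relation saying that two points are incomparable and have a meet of
    ramification order [o].  An elementarily equivalent structure in the
    second model carries a relation [r] with the first-order properties of the
    tree order and with finite support [A].  Choose [u] with no member of [A]
    above it.  All points above [u] are then conjugate over the rest of the
    tree, and so are all chains of two of them, which leaves very few
    possibilities for [r] above [u];
    the first-order properties exclude all of them but the order of the second
    tree ([invariant_tree_order_agrees]).  No point outside is [r]-above a point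
    of this region, and a point outside is [r]-below all or none of it, so the
    cones at meets inside the region are the same for [r] and for the tree
    order.  Having at least [k] cones is a first-order property; hence every
    ramification order of the first tree occurs in the second, and the same for
    the ramification order of the points themselves.  By symmetry the codes
    coincide. *)

(** * Sets over atoms *)

Lemma fm_eq_refl A (x : fm A) : fm_eq x x.
Proof. by elim: x => [a|J F IH] //=; split=> j; exists j. Qed.

Lemma fm_eq_sym A (x y : fm A) : fm_eq x y -> fm_eq y x.
Proof.
elim: x y => [a|J F IH] [b|K H] //= [h1 h2].
by split=> [k|j]; [have [j /IH] := h2 k; exists j | have [k /IH] := h1 j; exists k].
Qed.

Lemma fm_eq_trans A (y x z : fm A) : fm_eq x y -> fm_eq y z -> fm_eq x z.
Proof.
elim: x y z => [a|J F IH] [b|K H] [c|L M] //=; first by move=> ->.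
move=> [h1 h2] [h3 h4]; split=> [j|l].
  by have [k /IH e] := h1 j; have [l /e] := h3 k; exists l.
by have [k e] := h4 l; have [j /IH/(_ e)] := h2 k; exists j.
Qed.

Lemma fm_in_eql A (x x' y : fm A) : fm_eq x x' -> fm_in x y -> fm_in x' y.
Proof.
case: y => //= J F e [j h]; exists j; exact: fm_eq_trans (fm_eq_sym e) h.
Qed.

Lemma fm_in_eqr A (x y y' : fm A) : fm_eq y y' -> fm_in x y -> fm_in x y'.
Proof.
case: y y' => [//|J F] [//|K H] [h _] [j e].
by have [k e'] := h j; exists k; exact: fm_eq_trans e e'.
Qed.

Lemma fm_pair_inj A (x y x' y' : fm A) : fm_eq (fm_pair x y) (fm_pair x' y') ->
  fm_eq x x' /\ fm_eq y y' \/ fm_eq x y' /\ fm_eq y x'.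
Proof.
move=> [h1 h2]; have [k1 e1] := h1 true; have [k2 e2] := h1 false.
have [j1 e3] := h2 true; have [j2 e4] := h2 false.
case: k1 k2 j1 j2 e1 e2 e3 e4 => -[] [] [] //= *; by [left|right].
Qed.

(** Kuratowski's argument, for equality up to extensionality. *)
Lemma fm_opair_inj A (x y x' y' : fm A) :
  fm_eq (fm_opair x y) (fm_opair x' y') -> fm_eq x x' /\ fm_eq y y'.
Proof.
move=> /fm_pair_inj[[/fm_pair_inj e1 /fm_pair_inj e2]|[/fm_pair_inj e1 /fm_pair_inj e2]].
- have {}e1 : fm_eq x x' by case: e1 => -[].
  split=> //; case: e2 => -[] // e2 e3.
  exact: fm_eq_trans e3 (fm_eq_trans (fm_eq_sym e1) e2).
- have [{}e1 e3] : fm_eq x x' /\ fm_eq x y' by case: e1 => -[].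
  split=> //; have {}e2 : fm_eq y x' by case: e2 => -[].
  exact: fm_eq_trans e2 (fm_eq_trans (fm_eq_sym e1) e3).
Qed.

Lemma fm_pair_eq A (x y x' y' : fm A) :
  fm_eq x x' -> fm_eq y y' -> fm_eq (fm_pair x y) (fm_pair x' y').
Proof. by move=> e1 e2; split=> -[]; [exists true|exists false|exists true|exists false]. Qed.

Lemma fm_opair_eq A (x y x' y' : fm A) :
  fm_eq x x' -> fm_eq y y' -> fm_eq (fm_opair x y) (fm_opair x' y').
Proof. by move=> e1 e2; do 2?apply: fm_pair_eq. Qed.

Lemma fm_act_id A (x : fm A) : fm_act id x = x.
Proof. by elim: x => //= J F IH; congr coll; apply/funext => j. Qed.

Lemma fm_act_comp A (g h : A -> A) (x : fm A) :
  fm_act (g \o h) x = fm_act g (fm_act h x).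
Proof. by elim: x => //= J F IH; congr coll; apply/funext => j. Qed.

Lemma fm_act_eq A (g : A -> A) (x y : fm A) :
  fm_eq x y -> fm_eq (fm_act g x) (fm_act g y).
Proof.
elim: x y => [a|J F IH] [b|K H] //=; first by move=> ->.
move=> [h1 h2]; split=> [j|k].
  by have [k /IH] := h1 j; exists k.
by have [j /IH] := h2 k; exists j.
Qed.

Lemma fm_act_in A (g : A -> A) (x y : fm A) :
  fm_in x y -> fm_in (fm_act g x) (fm_act g y).
Proof. by case: y => //= J F [j /(fm_act_eq g)]; exists j. Qed.

Lemma fm_act_pair A (g : A -> A) (x y : fm A) :
  fm_act g (fm_pair x y) = fm_pair (fm_act g x) (fm_act g y).
Proof. by congr coll; apply/funext => -[]. Qed.

Lemma fm_act_opair A (g : A -> A) (x y : fm A) :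
  fm_act g (fm_opair x y) = fm_opair (fm_act g x) (fm_act g y).
Proof. by rewrite /fm_opair !fm_act_pair. Qed.

Lemma fm_act_succ A (g : A -> A) (x : fm A) :
  fm_act g (fm_succ x) = fm_succ (fm_act g x).
Proof. by case: x => //= J F; congr coll; apply/funext => -[]. Qed.

Lemma fm_act_nat A (g : A -> A) n : fm_act g (fm_nat n) = fm_nat n.
Proof.
elim: n => [|n IH]; first by congr coll; apply/funext => -[].
by rewrite /fm_nat iterS fm_act_succ -/(fm_nat n) IH.
Qed.

Lemma fm_tuple_inj A (s s' : seq A) :
  size s = size s' -> fm_eq (fm_tuple s) (fm_tuple s') -> s = s'.
Proof.
elim: s s' => [|a s IH] [|a' s'] //= [/IH{}IH].
by move=> /fm_opair_inj[/= -> /IH ->].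
Qed.

Lemma fm_act_tuple A (g : A -> A) (s : seq A) :
  fm_act g (fm_tuple s) = fm_tuple (map g s).
Proof.
elim: s => [|a s IH]; first by congr coll; apply/funext => -[].
by rewrite -[fm_tuple _]/(fm_opair (atom a) (fm_tuple s)) fm_act_opair IH.
Qed.

(** * Membership in the symmetric models *)

Definition supports A (G : set (A -> A)) (B : set A) (x : fm A) : Prop :=
  forall g, G g -> (forall a, B a -> g a = a) -> fm_eq (fm_act g x) x.

Lemma set_stabilizer_subgroup A (G : set (A -> A)) (x : fm A) :
  is_subgroup G G -> is_subgroup G (set_stabilizer G x).
Proof.
case=> _ Gid Gcomp Ginv; split.
- by move=> g [].
- by split=> //; rewrite fm_act_id; exact: fm_eq_refl.
- move=> g h [Gg eg] [Gh eh]; split; first exact: Gcomp.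
  by rewrite fm_act_comp; exact: fm_eq_trans (fm_act_eq g eh) eg.
- move=> g h [Gg eg] gK hK; split; first exact: Ginv gK hK.
  have /fm_eq_sym := fm_act_eq h eg; rewrite -fm_act_comp.
  by have -> : h \o g = id; [apply/funext => a /=; rewrite gK|rewrite fm_act_id].
Qed.

Lemma fm_model_supported A (G : set (A -> A)) (x : fm A) :
  fm_model G x -> exists2 B, finite_set B & supports G B x.
Proof.
case: x => [a|J F] /= [[_ [B [finB sB]]] _]; exists B => // g Gg gB;
  by have [] := sB g (conj Gg gB).
Qed.

Lemma fm_model_atom A (G : set (A -> A)) (a : A) :
  is_subgroup G G -> fm_model G (atom a).
Proof.
move=> sG; split=> //; split; first exact: set_stabilizer_subgroup.
by exists [set a]; split=> [|g [Gg ga]]; [exact: finite_set1|split=> //; exact: ga].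
Qed.

Lemma fm_model_coll A (G : set (A -> A)) (B : set A) J (F : J -> fm A) :
  is_subgroup G G -> finite_set B -> supports G B (coll J F) ->
  (forall j, fm_model G (F j)) -> fm_model G (coll J F).
Proof.
move=> sG finB supB mF; split=> //; split; first exact: set_stabilizer_subgroup.
by exists B; split=> // g [Gg gB]; split=> //; exact: supB.
Qed.

Lemma fm_model_pair A (G : set (A -> A)) (x y : fm A) : is_subgroup G G ->
  fm_model G x -> fm_model G y -> fm_model G (fm_pair x y).
Proof.
move=> sG mx my; have [B finB sB] := fm_model_supported mx.
have [C finC sC] := fm_model_supported my.
apply: (@fm_model_coll _ _ (B `|` C)) => [//||g Gg gBC|[]//].
  by rewrite finite_setU.
rewrite -/(fm_pair x y) fm_act_pair.
by apply: fm_pair_eq; [apply: sB|apply: sC] => // a ?; apply: gBC; [left|right].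
Qed.

Lemma fm_model_opair A (G : set (A -> A)) (x y : fm A) : is_subgroup G G ->
  fm_model G x -> fm_model G y -> fm_model G (fm_opair x y).
Proof. by move=> *; do 2?apply: fm_model_pair. Qed.

Lemma fm_model_opair_snd A (G : set (A -> A)) (x y : fm A) :
  fm_model G (fm_opair x y) -> fm_model G y.
Proof. by case=> _ /(_ false)[_ /(_ false)]. Qed.

Lemma supports_nat A (G : set (A -> A)) n : supports G set0 (fm_nat n).
Proof. by move=> g _ _; rewrite fm_act_nat; exact: fm_eq_refl. Qed.

Lemma fm_model_nat A (G : set (A -> A)) n : is_subgroup G G ->
  fm_model G (fm_nat n).
Proof.
move=> sG; elim: n => [|n IH].
  by apply: (fm_model_coll sG (finite_set0 _) (@supports_nat _ _ 0)) => -[].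
move: IH (@supports_nat _ G n.+1); rewrite /fm_nat iterS.
case: (iter n _ _) => //= J F mF sup.
by apply: (fm_model_coll sG (finite_set0 _) sup) => -[j|] //; case: mF => _ /(_ j).
Qed.

Lemma fm_model_tuple A (G : set (A -> A)) (s : seq A) : is_subgroup G G ->
  fm_model G (fm_tuple s).
Proof.
move=> sG; elim: s => [|a s IH]; first exact: (@fm_model_nat _ _ 0).
by apply: fm_model_opair => //; exact: fm_model_atom.
Qed.

Lemma fm_model_atoms A (G : set (A -> A)) : is_subgroup G G ->
  (forall g, G g -> bijective g) -> fm_model G (fm_atoms A).
Proof.
move=> sG bij; apply: (@fm_model_coll _ _ set0) => [//||g /bij[h hK gK] _|a].
- exact: finite_set0.
- by split=> a; [exists (g a)|exists (h a); rewrite /= gK].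
- exact: fm_model_atom.
Qed.

(** * Order-theoretic consequences of the hypotheses *)

(** Zorn's lemma is applied to the sets whose union with [C] is a chain, a family
    that contains the union of the empty chain. *)
Lemma exists_maximal_chain d (T : porderType d) (C : set T) :
  is_chain C -> exists2 M, is_maximal_chain M & C `<=` M.
Proof.
move=> chC; pose P (X : set T) := is_chain (X `|` C).
have [F FP totF|M [chM maxM]] := @Zorn_bigcup T P.
  move=> x y [[X FX Xx]|Cx] [[Y FY Yy]|Cy]; last exact: chC.
  - case: (totF X Y FX FY) => [XY|YX].
      by apply: (FP Y FY); left => //; exact: XY.
    by apply: (FP X FX); left => //; exact: YX.
  - by apply: (FP X FX); [left|right].
  - by apply: (FP Y FY); [right|left].
have CM : C `<=` M.
  move=> c Cc; apply: contrapT => nMc; apply: (maxM (M `|` C)).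
    by split=> [x ?|sub]; [left|apply: nMc; apply: sub; right].
  by rewrite /P -setUA setUid.
exists M => //; move: chM; rewrite /P setUidl// => chM; split=> // D chD MD.
apply: contrapT => nDM; apply: (maxM D).
  by split=> // DM; apply: nDM; exact/seteqP.
by rewrite /P setUidl//; exact: subset_trans MD.
Qed.

Lemma is_chain_pair d (T : porderType d) (x y : T) :
  x <= y -> is_chain [set z | z = x \/ z = y].
Proof.
by move=> xy a b [->|->] [->|->]; rewrite ?comparablexx // ?(le_comparable xy) // (ge_comparable xy).
Qed.

(** What the whole argument uses about the tree: weak 2-transitivity, a dense
    order without endpoints along each branch, and [bt_separate], which is the
    absence of special ramification points: [x] is not minimal among the points
    below [x] that leave the branch of [y]. *)
Record branching_tree {d} (T : porderType d) : Prop := BranchingTree {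
  bt_lower : forall x y : T, exists z, z <= x /\ z <= y;
  bt_chain : forall x y z : T, y <= x -> z <= x -> y >=< z;
  bt_trans : weakly_2_transitive T;
  bt_above : forall x : T, exists y, x < y;
  bt_below : forall x : T, exists y, y < x;
  bt_dense : forall x y : T, x < y -> exists z, x < z /\ z < y;
  bt_separate : forall x y : T, x >< y -> exists z, z < x /\ ~~ (z <= y);
  bt_branch : exists x y : T, x >< y }.

Lemma branching_treeP d (T : porderType d) : is_tree T ->
  weakly_2_transitive T -> nontrivial_tree T ->
  maximal_chains_dense (tplus T) -> branching_tree T.
Proof.
move=> [low lin] tr [chQ inc] dns.
(* Any comparable pair lies in a copy of the rationals. *)
have inQ (x y : T) : x <= y -> exists (f : rat -> T) p q,
    {mono f : x y / x <= y} /\ f p = x /\ f q = y.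
  move=> xy; have [M /chQ[f [mf rf]] sM] := exists_maximal_chain (is_chain_pair xy).
  have /= := sM x (or_introl erefl); rewrite -rf => -[p _ fp].
  have /= := sM y (or_intror erefl); rewrite -rf => -[q _ fq].
  by exists f, p, q.
split=> //.
- move=> x; have [f [p [_ [mf [<- _]]]]] := inQ x x (lexx x).
  by exists (f (p + 1)%R); rewrite (leW_mono mf) Num.Theory.ltrDl.
- move=> x; have [f [p [_ [mf [<- _]]]]] := inQ x x (lexx x).
  by exists (f (p - 1)%R); rewrite (leW_mono mf) Num.Theory.gtrBl.
- move=> x y xy; have [f [p [q [mf [fp fq]]]]] := inQ x y (ltW xy).
  move: xy; rewrite -fp -fq (leW_mono mf) => pq.
  have [h1 h2] := Num.Theory.midf_lt pq.
  by exists (f ((p + q) / 2%:R)%R); rewrite !(leW_mono mf).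
- move=> x y xy.
  (* Density of a maximal chain of T^+ through the meet of x and y and through x
     gives a member z of T^+ strictly between them. *)
  have lt : tmeet x y < tembed x.
    rewrite lt_neqAle; apply/andP; split; last by apply/asboolP => z [].
    apply/eqP => /(congr1 lower) /= e.
    have : common_lower x x x by [].
    by rewrite -e => -[_ h]; rewrite /Order.comparable h in xy.
  have [M maxM sM] := exists_maximal_chain (is_chain_pair (ltW lt)).
  have [z [_ l1 l2]] := dns M maxM _ _ (sM _ (or_introl erefl)) (sM _ (or_intror erefl)) lt.
  move: (l1); rewrite lt_neqAle => /andP[ne /asboolP sub].
  have [w [zw nw]] : exists w, lower z w /\ ~ lower (tmeet x y) w.
    apply: contrapT => h; move/negP: ne; apply; apply/eqP/le_anti/andP.
    split; apply/asboolP => // w zw; apply: contrapT => nw.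
    by apply: h; exists w.
  move: l2; rewrite lt_neqAle => /andP[ne2 /asboolP sub2].
  have [wx _] := sub2 w zw.
  exists w; split; last by apply/negP => wy; apply: nw.
  rewrite lt_neqAle wx andbT; apply/eqP => ewx; move/negP: ne2; apply.
  apply/eqP/le_anti/andP; split; apply/asboolP => // v [vx _].
  case: z zw {l1 ne sub sub2} => Z [a [b eZ]] /=; rewrite eZ => -[wa wb].
  by rewrite /= -ewx in vx; split; exact: le_trans vx _.
Qed.

(** * Gluing automorphisms above a point *)

Section Trees.
Context {d : Order.disp_t} {T : porderType d}.

Lemma automorphism_id : is_automorphism (@id T).
Proof. by split=> //; exists id. Qed.

Lemma automorphism_subgroup : is_subgroup (@is_automorphism d T) is_automorphism.
Proof.
split=> //; first exact: automorphism_id.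
- move=> g h [bg mg] [bh mh]; split; first exact: bij_comp.
  by move=> x y /=; rewrite mg mh.
- move=> g h [bg mg] gK hK; split; first by exists g.
  by move=> x y; rewrite -mg !hK.
Qed.

Definition glue (s : T) (p q : T -> T) (y : T) : T := if s <= y then q y else p y.

Lemma glue_mono (TC : forall x y z : T, y <= x -> z <= x -> y >=< z)
    s (p q : T -> T) : {mono p : x y / x <= y} -> {mono q : x y / x <= y} ->
  p s = q s -> {mono glue s p q : x y / x <= y}.
Proof.
move=> mp mq e x y; rewrite /glue; case: ifPn => sx; case: ifPn => sy //.
- have -> : (x <= y) = false.
    by apply/negP => xy; move: (le_trans sx xy); apply/negP.
  by apply/negP => /(le_trans (_ : p s <= q x)) ; rewrite e mq => /(_ sx); rewrite -e mp (negPf sy).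
- case xy: (x <= y).
    have xs : x <= s by case/orP: (TC _ _ _ xy sy) => // h; rewrite h in sx.
    by apply: (@le_trans _ _ (p s)); rewrite ?mp// e mq.
  apply/negP => h; have sq : q s <= q y by rewrite mq.
  have := TC _ _ _ h sq; rewrite -e /Order.comparable !mp (negPf sx) orbF => xs.
  by rewrite (le_trans xs sy) in xy.
Qed.

(** A point not above [s] lies below a point above [s] only if it lies below
    [s], where the two maps agree; hence the glued map preserves the order. *)
Lemma automorphism_glue (TC : forall x y z : T, y <= x -> z <= x -> y >=< z)
    s (p q : T -> T) : is_automorphism p -> is_automorphism q -> p s = q s ->
  is_automorphism (glue s p q).
Proof.
move=> [[p' pK p'K] mp] [[q' qK q'K] mq] e; split; last exact: glue_mono.
exists (glue (p s) p' q') => x; rewrite /glue.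
- by case sx: (s <= x); [rewrite e mq sx qK|rewrite mp sx pK].
- case sx: (p s <= x).
    by have -> : s <= q' x by rewrite -mq -e q'K.
  by have -> : (s <= p' x) = false by rewrite -mp p'K.
Qed.

End Trees.

(** * Points fixed by a finite support *)

(** Stated for an arbitrary relation, because it is also used for the order of
    a structure that is only elementarily equivalent to a tree. *)
Definition is_meet {D : Type} (r : D -> D -> Prop) (t x y : D) : Prop :=
  forall v, r v t <-> r v x /\ r v y.

Section BranchingTrees.
Context {d : Order.disp_t} {T : porderType d}.
Hypothesis bt : branching_tree T.

Let aut := @is_automorphism d T.
Let le (x y : T) : Prop := x <= y.

(** Some pair [u < a] has a branch leaving between [u] and [a], hence by weak
    2-transitivity every pair has one. *)
Lemma bt_fork (x y : T) : x < y -> exists z, x < z /\ z >< y.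
Proof.
move=> xy; have [a [b ab]] := bt_branch bt; have [u [ua ub]] := bt_lower bt a b.
have {}ua : u < a.
  by rewrite lt_neqAle ua andbT; apply: contra ab => /eqP <-; rewrite le_comparable.
have {}ub : u < b.
  rewrite lt_neqAle ub andbT; apply: contra ab => /eqP <-.
  by rewrite ge_comparable // ltW.
have [g [[_ mg] gu ga]] := bt_trans bt ua xy.
exists (g b); rewrite -gu -ga (leW_mono mg); split=> //.
by move: ab; rewrite /Order.comparable !mg orbC.
Qed.

(** Otherwise there are [u < s < v] such that each member of [B] above [u] is
    already above [v].  Then [s] can be moved inside the segment from [u] to [v],
    together with everything that branches off it, by an automorphism that is
    the identity on the points above [v] and on those not above [u]; it fixes
    [B]. *)
Lemma fixed_point_in_meet_closure (B : seq T) (s : T) :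
  (forall g, aut g -> {in B, forall b, g b = b} -> g s = s) ->
  s \in B \/ exists b b', [/\ b \in B, b' \in B & is_meet le s b b'].
Proof.
move=> fixs; apply: contrapT => /not_orP[/negP sB nmeet].
(* Two members of B above s have a common lower bound strictly above s. *)
have {nmeet} common b b' : b \in B -> b' \in B -> s <= b -> s <= b' ->
    exists w, [/\ s < w, w <= b & w <= b'].
  move=> bB bB' sb sb'; apply: contrapT => nw; apply: nmeet; exists b, b'; split=> // v.
  split=> [vs|[vb vb']]; first by split; exact: le_trans vs _.
  case/orP: (bt_chain bt vb sb) => // sv; move: sv; rewrite le_eqVlt => /orP[/eqP->|sv].
    exact: lexx.
  by case: nw; exists v.
have [u [us uB]] : exists u, u < s /\ {in B, forall b, ~~ (s <= b) -> ~~ (u <= b)}.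
  elim: B {fixs sB common} => [|b B [u [us IH]]].
    by have [u us] := bt_below bt s; exists u.
  have [w [ws wb]] : exists w, w < s /\ (~~ (s <= b) -> ~~ (w <= b)).
    case sb: (s <= b); first by exists u.
    case bs: (b <= s).
      have {}bs : b < s by rewrite lt_neqAle bs andbT; apply: contraFneq sb => ->.
      have [w [bw ws]] := bt_dense bt bs; exists w; split=> // _.
      by apply/negP => /(lt_le_trans bw); rewrite ltxx.
    have [|w [ws wb]] := bt_separate bt (x := s) (y := b).
      by rewrite /Order.comparable sb bs.
    by exists w.
  case/orP: (bt_chain bt (ltW us) (ltW ws)) => [uw|wu].
    exists w; split=> // c; rewrite inE => /orP[/eqP-> //|cB sc].
    by apply: contra (IH c cB sc); exact: le_trans.
  exists u; split=> // c; rewrite inE => /orP[/eqP-> sb|//]; last exact: IH.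
  by apply: contra (wb sb); exact: le_trans.
have [v [sv vB]] : exists v, s < v /\ {in B, forall b, s <= b -> v <= b}.
  case: (pselect (exists2 b0, b0 \in B & s <= b0)) => [[b0 b0B sb0]|nb]; last first.
    have [v sv] := bt_above bt s; exists v; split=> // b bB sb.
    by case: nb; exists b.
  have : {subset B <= B} by [].
  suff : forall C : seq T, {subset C <= B} ->
      exists v, [/\ s < v, v <= b0 & {in C, forall b, s <= b -> v <= b}].
    by move=> h /h[v [sv _ vB]]; exists v.
  elim=> [_|b C IH sub].
    by exists b0; split=> //; rewrite lt_neqAle sb0 andbT; apply: contraNneq sB => ->.
  have [|v [sv vb0 vC]] := IH; first by move=> c cC; apply: sub; rewrite inE cC orbT.
  case sb: (s <= b); last first.
    by exists v; split=> // c; rewrite inE => /orP[/eqP->|/vC//]; rewrite sb.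
  have [|w [sw wb wb0]] := common b b0 _ b0B sb sb0; first by apply: sub; rewrite mem_head.
  case/orP: (bt_chain bt vb0 wb0) => [vw|wv].
    exists v; split=> // c; rewrite inE => /orP[/eqP-> _|/vC//].
    exact: le_trans wb.
  exists w; split=> // c; rewrite inE => /orP[/eqP-> //|cC /(vC c cC)].
  exact: le_trans.
have uvB b : b \in B -> u <= b -> v <= b.
  by move=> bB ub; apply: vB => //; apply: contraTT ub; exact: uB.
(* The new position s' of s; p carries [u, s] to [u, s'] and q carries [s, v] to
   [s', v], and both are used only between u and v. *)
have [s' [us' s's]] := bt_dense bt us.
have [p [ap pu ps]] := bt_trans bt us us'.
have [q [aq qs qv]] := bt_trans bt sv (lt_trans s's sv).
have TC := bt_chain bt.
pose k := glue s p q; have ak : aut k by apply: automorphism_glue => //; rewrite ps qs.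
have ku : k u = u by rewrite /k /glue (lt_geF us) pu.
have kv : k v = v by rewrite /k /glue (ltW sv) qv.
pose k1 := glue v k id.
have ak1 : aut k1 by apply: automorphism_glue => //; exact: automorphism_id.
have k1u : k1 u = u by rewrite /k1 /glue (lt_geF (lt_trans us sv)).
have k1s : k1 s = s' by rewrite /k1 /glue (lt_geF sv) /k /glue lexx qs.
have := fixs (glue u id k1).
have -> : glue u id k1 s = s' by rewrite /glue (ltW us) k1s.
move=> e.
have : s' = s.
  apply: e; first by apply: automorphism_glue => //; exact: automorphism_id.
  move=> b bB; rewrite /glue; case: ifPn => // ub.
  by rewrite /k1 /glue uvB.
by move=> es; rewrite es ltxx in s's.
Qed.

(** * Partial surjections of the tree onto itself *)

(** The images of [t] allowed by [fixed_point_in_meet_closure] are [t], the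
    points of the finite set [F] attached to [B], and meets of [t] with members
    of [B].  The latter lie below [B], and when [t] itself lies below [B] they
    are [t] or points of [F].  So a point outside [F] is only hit from itself,
    and [F] must be covered by itself, injectively as [rho] is functional. *)
Lemma partial_surjection_total (B : seq T) (rho : T -> T -> Prop) :
  (forall g, aut g -> {in B, forall b, g b = b} ->
     forall t s, rho t s -> rho (g t) (g s)) ->
  (forall t s s', rho t s -> rho t s' -> s = s') ->
  (forall s, exists t, rho t s) ->
  forall t, exists s, rho t s.
Proof.
move=> inv fct surj.
(* When b and b' have no meet in T, the default value of xget only repeats b. *)
pose F := undup (B ++ [seq xget b [set s | is_meet le s b b'] | b <- B, b' <- B]).
have meet_uniq b b' s s' : is_meet le s b b' -> is_meet le s' b b' -> s = s'.
  move=> m m'; apply/le_anti/andP.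
  split; first by apply/m'/m; exact: lexx.
  by apply/m/m'; exact: lexx.
have BF b : b \in B -> b \in F by move=> bB; rewrite mem_undup mem_cat bB.
have meetF b b' s : b \in B -> b' \in B -> is_meet le s b b' -> s \in F.
  move=> bB b'B m; rewrite mem_undup mem_cat; apply/orP; right.
  apply/allpairsP; exists (b, b'); split=> //=; apply: (meet_uniq b b') => //.
  by apply: (@xgetPex _ b [set s | is_meet le s b b']); exists s.
have image t s : rho t s ->
    [\/ s = t, s \in F | exists b, b \in B /\ is_meet le s b t].
  move=> rts.
  have [g ag gB| |] := @fixed_point_in_meet_closure (t :: B) s.
  - have gt : g t = t by apply: gB; rewrite mem_head.
    apply: (fct t); last by [].
    rewrite -{1}gt; apply: inv => // b bB; apply: gB.
    by rewrite inE bB orbT.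
  - rewrite inE => /orP[/eqP->|/BF ?]; first exact: Or31.
    exact: Or32.
  - move=> [b [b' [+ + m]]]; rewrite !inE => /orP[/eqP eb|bB] /orP[/eqP eb'|b'B].
    + rewrite eb eb' in m; apply: Or31; apply: meet_uniq m _ => v.
      by split=> // -[].
    + apply: Or33; exists b'; split=> //; rewrite -eb => v.
      by rewrite m; split=> -[].
    + by apply: Or33; exists b; rewrite -eb'.
    + by apply: Or32; exact: meetF m.
pose below t := exists2 b, b \in B & t <= b.
have Fbelow s : s \in F -> below s.
  rewrite mem_undup mem_cat => /orP[sB|/allpairsP[[b b'] /= [bB b'B ->]]].
    by exists s.
  exists b => //; case: xgetP => // x _ m; by have [/(_ (lexx x))[]] := m x.
have meet_below s b t : is_meet le s b t -> s <= b /\ s <= t.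
  by move=> m; have [/(_ (lexx s))] := m s.
have out t s : ~ below s -> rho t s -> s = t.
  move=> nb /image[//|/Fbelow//|[b [bB /meet_below[sb _]]]].
  by case: nb; exists b.
have inside t s : below t -> rho t s -> s = t \/ s \in F.
  move=> [b0 b0B tb0] /image[|sF|[b [bB m]]]; [by left|by right|].
  case tb: (t <= b).
    left; apply: meet_uniq m _ => v; split=> [vt|[]//].
    by split=> //; exact: le_trans tb.
  right; apply: (meetF b b0) => // v; rewrite m; split=> -[vb].
    by move=> vt; split=> //; exact: le_trans tb0.
  move=> vb0; split=> //; case/orP: (bt_chain bt vb0 tb0) => // tv.
  by rewrite (le_trans tv vb) in tb.
have off t s : s \notin F -> rho t s -> s = t.
  move=> sF rts; case: (pselect (below s)) => [bs|/out/(_ rts)//].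
  case: (pselect (below t)) => [/inside/(_ rts)[//|h]|nbt]; first by rewrite h in sF.
  have [t' rt't] := surj t; have et := out _ _ nbt rt't; rewrite -et in rt't.
  by have es := fct _ _ _ rts rt't.
have stay s : s \notin F -> rho s s.
  by move=> sF; have [t rts] := surj s; move: (rts); rewrite -(off t s).
(* A right inverse of rho maps the finite set F injectively into itself, hence
   onto itself. *)
have [c cP] := choice surj.
have cF s : s \in F -> c s \in F.
  move=> sF; apply: contraT => ncF.
  by rewrite (fct _ _ _ (cP s) (stay _ ncF)) (negPf ncF) in sF.
have cinj : injective c by move=> s s' e; apply: (fct (c s)) => //; rewrite e.
have mapF : map c F =i F.
  have u : uniq (map c F) by rewrite map_inj_uniq // undup_uniq.
  have sub : {subset map c F <= F} by move=> _ /mapP[s sF ->]; exact: cF.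
  by have [] := uniq_min_size u sub; rewrite ?size_map.
move=> t; case tF: (t \in F); last by exists t; apply: stay; rewrite tF.
by move: tF; rewrite -mapF => /mapP[s _ ->]; exists s.
Qed.

End BranchingTrees.

(** * Counting cones inside an arbitrary relation *)

Section ConeCounting.
Context {D : Type}.
Implicit Types r : D -> D -> Prop.

(** In a tree this says that the meet of [x] and [y], which may be missing, lies
    strictly below [z]. *)
Definition above_meet r (x y z : D) : Prop :=
  (forall v, r v x -> r v y -> r v z) /\ ~ (r z x /\ r z y).

(** For [z] and [w] above the meet of [x] and [y], this says that they lie in
    different cones at that meet. *)
Definition cone_separated r (x y z w : D) : Prop :=
  forall v, r v z -> r v w -> r v x /\ r v y.

Fixpoint separated_from r (x y z : D) (l : seq D) : Prop :=
  if l is w :: l' then cone_separated r x y z w /\ separated_from r x y z l'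
  else True.

(** There are [k] points in distinct cones at the meet of [x] and [y], which also
    avoid the cones of the members of [l].  Picking the points one at a time
    matches the formula that expresses this property. *)
Fixpoint cones_ge r (x y : D) (k : nat) (l : seq D) : Prop :=
  if k is k'.+1 then
    exists z, [/\ above_meet r x y z, separated_from r x y z l
                & cones_ge r x y k' (z :: l)]
  else True.

(** With an order for [r], a point outside [R] lies below all points of [R] or
    below none, and never above one.  Meets and cones computed at two points
    with a common lower bound in [R] then only depend on the restriction of [r]
    to [R]. *)
Definition insulated r (R : set D) : Prop :=
  (forall v x y, ~ R v -> R x -> R y -> r v x -> r v y) /\
  (forall v x, ~ R v -> R x -> ~ r x v).

Lemma is_meet_insulated r r' (R : set D) (t x y : D) :
  insulated r R -> insulated r' R ->
  (forall v w, R v -> R w -> (r v w <-> r' v w)) ->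
  R t -> R x -> R y -> is_meet r t x y -> is_meet r' t x y.
Proof.
move=> [low _] [low' _] agree Rt Rx Ry m v.
case: (pselect (R v)) => Rv; first by rewrite -!agree.
by split=> [vt|[vx _]]; [split; apply: low' vt|apply: low' vx].
Qed.

Lemma cones_ge_insulated r r' (R : set D) (a x y : D) k (l : seq D) :
  insulated r R -> insulated r' R ->
  (forall v w, R v -> R w -> (r v w <-> r' v w)) ->
  R a -> R x -> R y -> r a x -> r a y -> (forall i, R (nth a l i)) ->
  cones_ge r x y k l -> cones_ge r' x y k l.
Proof.
move=> [low high] [low' high'] agree Ra Rx Ry ax ay.
elim: k l => //= k IH l Rl [z [[abz nz] sep /IH{}IH]].
(* The common lower bound a forces z into the region. *)
have Rz : R z by apply: contrapT => nRz; apply: (high z a) => //; exact: abz.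
exists z; split.
- split=> [v vx vy|]; last by rewrite -!agree.
  case: (pselect (R v)) => Rv; last exact: low' vx.
  by apply/agree => //; apply: abz; apply/agree.
- elim: l Rl sep {IH} => //= w l IH Rl [sep /IH{}IH]; split; last first.
    by apply: IH => i; exact: (Rl i.+1).
  have Rw := Rl 0%N; move=> v vz vw.
  case: (pselect (R v)) => Rv; last by split; exact: low' vz.
  by rewrite -!agree //; apply: sep; apply/agree.
- by apply: IH => -[|i] /=.
Qed.

End ConeCounting.

(** * Invariant tree orders *)

Section Insulation.
Context {d : Order.disp_t} {T : porderType d}.
Hypothesis bt : branching_tree T.

Let aut := @is_automorphism d T.
Let le (x y : T) : Prop := x <= y.

Lemma move_above (u x y : T) : u < x -> u < y ->
  exists g, [/\ aut g, (forall z, ~ u < z -> g z = z) & g x = y].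
Proof.
move=> ux uy; have [h [ah hu hx]] := bt_trans bt ux uy.
exists (glue u id h); split.
- apply: automorphism_glue => //; first exact: bt_chain bt.
  exact: automorphism_id.
- move=> z nz; rewrite /glue; case: ifPn => // uz.
  by move: uz nz; rewrite le_eqVlt => /orP[/eqP<-|->].
- by rewrite /glue (ltW ux).
Qed.

Lemma move_chain_above (u x y x' y' : T) : u < x -> x < y -> u < x' -> x' < y' ->
  exists g, [/\ aut g, (forall z, ~ u < z -> g z = z), g x = x' & g y = y'].
Proof.
move=> ux xy ux' xy'; have [h [ah hz hx]] := move_above ux ux'.
have [k [ak kx ky]] := bt_trans bt xy xy'.
exists (glue x h k); split.
- by apply: automorphism_glue => //; [exact: bt_chain bt|rewrite hx].
- move=> z nz; rewrite /glue ifN ?hz //; apply/negP => xz.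
  exact: nz (lt_le_trans ux xz).
- by rewrite /glue lexx.
- by rewrite /glue (ltW xy).
Qed.

(** If [A] is not empty, one of its maximal elements has this property. *)
Lemma exists_free_point (A : seq T) : exists u : T, {in A, forall a, ~ u < a}.
Proof.
elim: A => [|a A [u uA]]; first by have [x _] := bt_branch bt; exists x.
case: (pselect (u < a)) => ua; last first.
  by exists u => b; rewrite inE => /orP[/eqP->|/uA].
exists a => b; rewrite inE => /orP[/eqP->|/uA ub ab]; first by rewrite ltxx.
exact: ub (lt_trans ua ab).
Qed.

Section Relation.
Variables (A : seq T) (r : T -> T -> Prop).
Hypothesis r_inv : forall g, aut g -> {in A, forall a, g a = a} ->
  forall x y, r x y -> r (g x) (g y).
Hypothesis r_refl : forall x, r x x.
Hypothesis r_tree : forall x y z, r y x -> r z x -> r y z \/ r z y.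
Hypothesis r_fork : forall x y, r x y -> x <> y ->
  exists z, [/\ r x z, ~ r z y & ~ r y z].
Hypothesis r_separate : forall x y, ~ r x y -> ~ r y x ->
  exists z, [/\ r z x, z <> x & ~ r z y].

Let free u := {in A, forall a, ~ u < a}.

Let free_above u p : free u -> u < p -> free p.
Proof. by move=> fu up a /fu ua pa; apply: ua; exact: lt_trans pa. Qed.

Let inv_point u x y z : free u -> u < x -> u < y -> ~ u < z ->
  (r z x -> r z y) /\ (r x z -> r y z).
Proof.
move=> fu ux uy nz; have [g [ag gz gx]] := move_above ux uy.
have gA : {in A, forall a, g a = a} by move=> a /fu; exact: gz.
by rewrite -gx -{2 4}(gz z nz); split; exact: r_inv.
Qed.

Let inv_chain u x y x' y' : free u -> u < x -> x < y -> u < x' -> x' < y' ->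
  (r x y -> r x' y') /\ (r y x -> r y' x').
Proof.
move=> fu ux xy ux' xy'; have [g [ag gz gx gy]] := move_chain_above ux xy ux' xy'.
have gA : {in A, forall a, g a = a} by move=> a /fu; exact: gz.
by rewrite -gx -gy; split; exact: r_inv.
Qed.

(** A branch leaving, in the sense of [r], between two points above [u] would have
    to leave the region, and a point outside compares in the same way with all
    points above [u]. *)
Let not_linear u : free u -> ~ (forall x y, u < x -> u < y -> r x y \/ r y x).
Proof.
move=> fu lin; have [x ux] := bt_above bt u; have [y xy] := bt_above bt x.
have uy := lt_trans ux xy.
have nxy : x <> y by move=> e; rewrite e ltxx in xy.
suff key a b : u < a -> u < b -> a <> b -> ~ r a b.
  by case: (lin x y ux uy); apply: key => // /esym.
move=> ua ub nab rab; have [w [raw nwb nbw]] := r_fork rab nab.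
case: (pselect (u < w)) => uw; first by case: (lin w b uw ub).
by apply: nbw; exact: (inv_point fu ua ub uw).2.
Qed.

(** If [r x y] for incomparable points, the whole set of points above some [p]
    on the branch of [x] is [r]-below [y], as the points above [p] are conjugate
    over [y].  It is then linearly ordered by [r]. *)
Let incomparable_above u x y : free u -> u < x -> u < y -> x >< y -> ~ r x y.
Proof.
move=> fu ux uy xy rxy; have [p [px npy]] := bt_separate bt xy.
have up : u < p.
  rewrite lt_neqAle; apply/andP.
  case/orP: (bt_chain bt (ltW ux) (ltW px)) => [up|pu]; last first.
    by rewrite (le_trans pu (ltW uy)) in npy.
  by split=> //; apply: contraNneq npy => <-; exact: ltW.
have fp := free_above fu up.
have npy' : ~ p < y by move=> /ltW; apply/negP.
apply: (not_linear fp) => a b pa pb; apply: (@r_tree y).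
  exact: (inv_point fp px pa npy').2.
exact: (inv_point fp px pb npy').2.
Qed.

(** Reversing the order would put two incomparable points [r]-below a common
    one. *)
Let not_reversed u x y : free u -> u < x -> x < y -> ~ r y x.
Proof.
move=> fu ux xy ryx; have [z [xz zy]] := bt_fork bt xy.
have rzx := (inv_chain fu ux xy ux xz).2 ryx.
case: (r_tree ryx rzx); apply: (incomparable_above fu) => //;
  by rewrite ?(lt_trans ux) // comparable_sym.
Qed.

(** Otherwise the points above [u] form an [r]-antichain with the same points
    [r]-below all of them, against [r_separate]. *)
Let agree_lt u x y : free u -> u < x -> x < y -> r x y.
Proof.
move=> fu ux xy; apply: contrapT => nr; have uy := lt_trans ux xy.
have anti a b : u < a -> u < b -> r a b -> a = b.
  move=> ua ub rab; apply: contrapT => nab.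
  case cab: (a >=< b); last by apply: (incomparable_above fu ua ub _ rab); rewrite cab.
  case: (comparable_ltgtP cab) => // lt.
    by apply: nr; exact: (inv_chain fu ua lt ux xy).1.
  exact: (not_reversed fu ub lt rab).
have nyx : ~ r y x by exact: not_reversed fu ux xy.
have [z [rzx nzx nzy]] := r_separate nr nyx.
case: (pselect (u < z)) => uz; first by apply: nzx; exact: anti.
by apply: nzy; exact: (inv_point fu ux uy uz).1.
Qed.

Theorem invariant_tree_order_agrees : exists u : T,
  [/\ insulated r [set x | u < x],
      insulated le [set x | u < x]
    & forall x y, u < x -> u < y -> (r x y <-> x <= y)].
Proof.
have [u fu] := exists_free_point A; exists u; split.
- split=> [v x y|v x] /= nv ux; first by move=> uy; exact: (inv_point fu ux uy nv).1.
  move=> rxv; apply: (not_linear fu) => a b ua ub; apply: (@r_tree v).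
    exact: (inv_point fu ux ua nv).2.
  exact: (inv_point fu ux ub nv).2.
- split=> [v x y|v x] /= nv ux; last by move=> /(lt_le_trans ux).
  rewrite /le => uy vx; case/orP: (bt_chain bt vx (ltW ux)) => [vu|].
    exact: le_trans (ltW uy).
  rewrite le_eqVlt => /orP[/eqP <-|//]; exact: ltW.
- move=> x y ux uy; split=> [rxy|]; last first.
    by rewrite le_eqVlt => /orP[/eqP->|/(agree_lt fu ux)].
  apply: contraT => nxy; case cyx: (y <= x); last first.
    by case: (@incomparable_above u x y) => //; rewrite /Order.comparable cyx (negPf nxy).
  case: (@not_reversed u y x) => //; rewrite lt_neqAle cyx andbT.
  by apply: contraNneq nxy => ->.
Qed.

End Relation.
End Insulation.

(** * Cones and ramification orders *)

Definition has_order {D : Type} (r : D -> D -> Prop) (x y : D) (o : ram_number) : Prop :=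
  match o with
  | Some n => cones_ge r x y n [::] /\ ~ cones_ge r x y n.+1 [::]
  | None => forall n, cones_ge r x y n [::]
  end.

(** [cones_ge] in terms of a sequence of representatives, the form suited to
    counting. *)
Lemma cones_geP (D : Type) (r : D -> D -> Prop) x y k (l : seq D) :
  cones_ge r x y k l <-> exists f : nat -> D,
    (forall i, (i < k)%N -> above_meet r x y (f i) /\ separated_from r x y (f i) l) /\
    (forall i j, (i < j)%N -> (j < k)%N -> cone_separated r x y (f j) (f i)).
Proof.
elim: k l => [|k IH] l /=; first by split=> // _; exists (fun=> x).
split=> [[z [az sz /IH[f [f1 f2]]]]|[f [f1 f2]]].
  exists (fun i => if i is i'.+1 then f i' else z); split=> [[|i] ik|[|i] [|j] //=].
  - by [].
  - by have [h [_ ?]] := f1 i ik.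
  - by move=> _ jk; have [_ []] := f1 j jk.
  - by move=> ij jk; exact: (f2 i j).
exists (f 0%N); have [a0 s0] := f1 0%N isT; split=> //; apply/IH.
exists (f \o succn); split=> [i ik|i j ij jk] /=; last exact: f2.
by have [ai si] := f1 i.+1 ik; split=> //; split=> //; exact: (f2 0%N i.+1).
Qed.

Lemma cones_ge_map (D : Type) (r : D -> D -> Prop) (g : D -> D) :
  bijective g -> (forall x y, r (g x) (g y) <-> r x y) ->
  forall x y k, cones_ge r x y k [::] -> cones_ge r (g x) (g y) k [::].
Proof.
move=> [h gK hK] mg x y k /cones_geP[f [f1 f2]]; apply/cones_geP.
exists (g \o f); split=> [i /f1[[a1 a2] _]|i j ij jk v] /=; last first.
  by rewrite -(hK v) !mg; exact: f2.
split=> //; split=> [v|]; last by rewrite !mg.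
by rewrite -(hK v) !mg; exact: a1.
Qed.

Section Cones.
Context {d : Order.disp_t} {T : porderType d}.
Hypothesis TC : forall x y z : T, y <= x -> z <= x -> y >=< z.

Let le (x y : T) : Prop := x <= y.

Lemma tplus_ltP (x y : tplus T) :
  x < y <-> lower x `<=` lower y /\ exists2 w, lower y w & ~ lower x w.
Proof.
split=> [xy|[/asboolP xy [w yw nxw]]].
  split; first by apply/asboolP; exact: (ltW xy).
  apply: contrapT => n; have : y <= x.
    by apply/asboolP => w yw; apply: contrapT => nxw; apply: n; exists w.
  by apply/negP; rewrite (lt_geF xy).
rewrite lt_neqAle [x <= y]xy andbT; apply/eqP => e; apply: nxw; by rewrite e.
Qed.

Lemma lower_down (x : tplus T) (v w : T) : lower x w -> v <= w -> lower x v.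
Proof.
rewrite /lower; have [a [b ->]] := proj2_sig x; move=> [wa wb] vw; split; exact: le_trans vw _.
Qed.

(** Members of [T^+] below a common one are down-sets of one branch. *)
Lemma tplus_chain (x y z : tplus T) : y <= x -> z <= x -> y >=< z.
Proof.
move=> /asboolP yx /asboolP zx; apply: contraT => /norP[/asboolPn nyz /asboolPn nzy].
have [v yv nzv] : exists2 v, lower y v & ~ lower z v.
  by apply: contrapT => n; apply: nyz => v yv; apply: contrapT => ?; apply: n; exists v.
have [w zw nyw] : exists2 v, lower z v & ~ lower y v.
  by apply: contrapT => n; apply: nzy => u zu; apply: contrapT => ?; apply: n; exists u.
have [a] : exists a, v <= a /\ w <= a.
  have [a [b ex]] := proj2_sig x; rewrite /lower ex in yx zx; exists a.
  by have [? _] := yx v yv; have [? _] := zx w zw.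
case=> va wa; case/orP: (TC va wa) => [vw|wv].
  by case: nzv; exact: lower_down vw.
by case: nyw; exact: lower_down wv.
Qed.

Lemma same_cone_trans (x y z w : tplus T) :
  same_cone x y z -> same_cone x z w -> same_cone x y w.
Proof.
move=> [t [xt ty tz]] [s [xs sz sw]]; case/orP: (tplus_chain tz sz) => h.
  by exists t; split=> //; exact: le_trans sw.
by exists s; split=> //; exact: le_trans ty.
Qed.

Lemma same_cone_sym (x y z : tplus T) : same_cone x y z -> same_cone x z y.
Proof. by move=> [t [*]]; exists t. Qed.

Let cone (x : tplus T) (z : T) : set (tplus T) :=
  [set w | x < w /\ same_cone x (tembed z) w].

Lemma above_meetE (a b z : T) : above_meet le a b z <-> tmeet a b < tembed z.
Proof.
rewrite tplus_ltP /=; split=> [[h n]|[h [w [wz _] nw]]].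
  by split=> [v [/h{}h /h ?]|]; [split|exists z].
split=> [v va vb|[za zb]]; first by case: (h v).
by apply: nw; split; exact: le_trans wz _.
Qed.

(** Every cone contains points of [T], so the cones can be counted with
    representatives in [T]. *)
Lemma conesE (x : tplus T) K :
  cones x K <-> exists z : T, x < tembed z /\ K = cone x z.
Proof.
split=> [[y [xy ->]]|[z [xz ->]]]; last by exists (tembed z).
have [sub [w yw nxw]] := (tplus_ltP x y).1 xy.
have wy : tembed w <= y by apply/asboolP => v [vw _]; exact: lower_down vw.
have xw : x < tembed w.
  case/orP: (tplus_chain wy (ltW xy)) => [/asboolP h|].
    by case: nxw; apply: h; split; exact: lexx.
  rewrite le_eqVlt => /orP[/eqP e|//]; case: nxw; rewrite e; split; exact: lexx.
have yw' : same_cone x y (tembed w) by exists (tembed w).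
exists w; split=> //; apply/seteqP; split=> v [xv sv]; split=> //.
  exact: same_cone_trans (same_cone_sym yw') sv.
exact: same_cone_trans yw' sv.
Qed.

Lemma cone_eqE (a b z z' : T) :
  tmeet a b < tembed z -> tmeet a b < tembed z' ->
  (cone (tmeet a b) z = cone (tmeet a b) z' <-> ~ cone_separated le a b z z').
Proof.
move=> xz xz'; split=> [e sep|nsep].
  have : cone (tmeet a b) z' (tembed z').
    by split=> //; exists (tembed z').
  rewrite -e => -[_ [t [xt /asboolP tz /asboolP tz']]].
  have [_ [w tw nw]] := (tplus_ltP _ _).1 xt; apply: nw.
  by have [wz _] := tz w tw; have [wz' _] := tz' w tw; exact: sep.
have [v [vz [vz' nv]]] : exists v, le v z /\ le v z' /\ ~ (le v a /\ le v b).
  by apply: contrapT => n; apply: nsep => v vz vz'; apply: contrapT => nv; apply: n; exists v.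
have zz' : same_cone (tmeet a b) (tembed z) (tembed z').
  exists (tembed v); rewrite !tembed_mono; split=> //.
  apply/tplus_ltP; split; last by exists v.
  move=> w [wa wb]; have [/(_ w (conj wa wb))[wz _] _] := (tplus_ltP _ _).1 xz.
  case/orP: (TC vz wz) => [vw|//].
  by case: nv; split; exact: le_trans vw _.
apply/seteqP; split=> w [xw sw]; split=> //.
  exact: same_cone_trans (same_cone_sym zz') sw.
exact: same_cone_trans zz' sw.
Qed.

Lemma card_conesE (a b : T) k :
  cones_ge le a b k [::] <-> (`I_k #<= cones (tmeet a b))%card.
Proof.
rewrite cones_geP; split=> [[f [f1 f2]]|].
  have af i : (i < k)%N -> tmeet a b < tembed (f i).
    by move=> /f1[/above_meetE].
  apply: (@card_le_trans _ _ _ ((cone (tmeet a b) \o f) @` `I_k)); last first.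
    by apply: subset_card_le => _ [i ik <-]; apply/conesE; exists (f i); split=> //; exact: af.
  have inj : {in `I_k &, injective (cone (tmeet a b) \o f)}.
    move=> i j /set_mem ik /set_mem jk /= e; apply: contrapT => nij.
    case: (ltngtP i j) => // ij.
      by apply: ((cone_eqE (af j jk) (af i ik)).1 (esym e)); exact: f2.
    by apply: ((cone_eqE (af i ik) (af j jk)).1 e); exact: f2.
  by have := inj_card_eq inj; rewrite card_eq_le => /andP[].
case/pcard_leP => g.
have /choice[f fP] : forall i, exists z, (i < k)%N ->
    tmeet a b < tembed z /\ g i = cone (tmeet a b) z.
  move=> i; case: (ltnP i k) => ik; last by exists a.
  have /conesE[z zP] : cones (tmeet a b) (g i) by apply: funS.
  by exists z.
exists f; split=> [i ik|i j ij jk].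
  by split=> //; apply/above_meetE; have [] := fP i ik.
have ik := ltn_trans ij jk.
have [ai ei] := fP i ik; have [aj ej] := fP j jk.
apply: contrapT => /(cone_eqE aj ai); rewrite -ei -ej => e.
have : j = i by apply: (@inj _ _ _ g); rewrite ?inE.
by move=> eji; rewrite eji ltnn in ij.
Qed.

(** The ramification order is thereby read off from the order of [T] alone,
    which makes it first-order and invariant under automorphisms. *)
Lemma has_ramification_orderE (a b : T) o :
  has_ramification_order (tmeet a b) o <-> has_order le a b o.
Proof.
case: o => [n|]; rewrite /has_order /has_ramification_order; last first.
  rewrite infiniteP; split=> [inf k|all].
    by apply/card_conesE; apply: card_le_trans inf; exact: card_leT.
  apply/infiniteP => /finite_setP[n].
  have /card_conesE := all n.+1; rewrite card_eq_le => h /andP[h' _].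
  by have := card_le_trans h h'; rewrite card_le_II ltnn.
rewrite !card_conesE; split=> [|[h nh]].
  rewrite card_eq_le => /andP[h1 h2]; split=> // h.
  by have := card_le_trans h h1; rewrite card_le_II ltnn.
have /finite_setP[m em] : finite_set (cones (tmeet a b)).
  apply: contrapT => /infiniteP inf; apply: nh.
  by apply: card_le_trans inf; exact: card_leT.
suff -> : n = m by [].
move: h nh; rewrite !(card_le_eqr em) !card_le_II => h nh.
by apply/eqP; rewrite eqn_leq h leqNgt; apply/negP.
Qed.

Lemma has_ramification_order_uniq (x : tplus T) o o' :
  has_ramification_order x o -> has_ramification_order x o' -> o = o'.
Proof.
case: o o' => [n|] [m|] //= h h'.
- by congr Some; apply/card_eq_II; exact: card_eq_trans (card_esym h) h'.
- by case: h'; apply/finite_setP; exists n.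
- by case: h; apply/finite_setP; exists m.
Qed.

Lemma has_order_automorphism (g : T -> T) x y o : is_automorphism g ->
  has_order le (g x) (g y) o <-> has_order le x y o.
Proof.
suff key g' x' y' : is_automorphism g' ->
    has_order le x' y' o -> has_order le (g' x') (g' y') o.
  move=> ag; split; last exact: key; have [[h gK hK] _] := ag.
  have [_ _ _ inv] := @automorphism_subgroup d T.
  by rewrite -{2}(gK x) -{2}(gK y); apply: key; exact: inv gK hK.
have half g1 x1 y1 k : is_automorphism g1 ->
    cones_ge le x1 y1 k [::] -> cones_ge le (g1 x1) (g1 y1) k [::].
  by move=> [bg mg]; apply: cones_ge_map => // u v; rewrite /le mg.
move=> ag; have [[h gK hK] _] := ag.
have [_ _ _ inv] := @automorphism_subgroup d T.
have ah := inv _ _ ag gK hK.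
case: o => [n [h1 h2]|h1]; last by move=> n; exact: half.
by split; [exact: half|move=> /(half _ _ _ _ ah); rewrite !gK].
Qed.

End Cones.

(** * The atoms belong to the class Delta_5 and not to Delta_4 *)

Section Classes.
Context {d : Order.disp_t} {T : porderType d}.
Hypothesis bt : branching_tree T.

Let le (x y : T) : Prop := x <= y.

Lemma tree_model_atoms : tree_model T (fm_atoms T).
Proof. by apply: fm_model_atoms; [exact: automorphism_subgroup|move=> g []]. Qed.

Lemma finite_set_mem (B : set T) : finite_set B ->
  exists s : seq T, forall x, B x <-> x \in s.
Proof. by move=> /finite_seqP[s ->]; exists s. Qed.

Lemma Delta5_atoms : Delta5 (tree_model T) (fm_atoms T).
Proof.
split=> //; first exact: tree_model_atoms.
move=> [Y [f [NY Nf [setY subY [z [zY nz]]] [[setf _ fun_f] surj_f]]]].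
have [B /finite_set_mem[s sB] suppB] := fm_model_supported Nf.
(* The part of f with values among the atoms is a partial map of T onto T. *)
pose rho (t u : T) := fm_in (fm_opair (atom t) (atom u)) f.
have [x [[t xt] xz]] := surj_f z zY.
have {}xz : fm_in (fm_opair (atom t) z) f.
  by apply: fm_in_eql xz; apply: fm_opair_eq => //; exact: fm_eq_refl.
have tU : fm_in (atom t) (fm_atoms T) by exists t.
have [|t1 u u' h h'|u|u rtu] := @partial_surjection_total _ _ bt s rho _ _ _ t.
- move=> g ag gs t1 u rtu.
  rewrite /rho -[atom (g t1)]/(fm_act g (atom t1)) -[atom (g u)]/(fm_act g (atom u)).
  rewrite -fm_act_opair; apply: fm_in_eqr (fm_act_in g rtu).
  by apply: suppB => // b /sB; exact: gs.
- have [|y [_ uniq_y]] := fun_f (atom t1); first by exists t1.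
  exact: fm_eq_trans (uniq_y _ h) (fm_eq_sym (uniq_y _ h')).
- have [|y [[t1 yt1] ytu]] := surj_f (atom u); first by apply: subY; exists u.
  by exists t1; apply: fm_in_eql ytu; apply: fm_opair_eq => //; exact: fm_eq_refl.
- apply: nz; exists u; have [y [_ uniq_y]] := fun_f _ tU.
  exact: fm_eq_trans (uniq_y _ xz) (fm_eq_sym (uniq_y _ rtu)).
Qed.

(** An atom [s] is sent to the index, in an injective sequence of ramification
    orders, of the ramification order of the meet of [t0] and [s].  Every
    ramification order occurs at such a meet, because a pair realising it can be
    moved so that one of its members becomes [t0]. *)
Lemma not_Delta4_atoms :
  infinite_set (ramification_orders T) -> ~ Delta4 (tree_model T) (fm_atoms T).
Proof.
move=> /infiniteP/pcard_leP[e] [_ _]; apply.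
have TC := bt_chain bt.
have [t0 [_ _]] := bt_branch bt.
pose idx_set s : set nat := [set n | has_order le t0 s (e n)].
(* The value 0 is used when the ramification order is not in the sequence. *)
pose idx s := xget 0%N (idx_set s).
have idx_inv g s : is_automorphism g -> g t0 = t0 -> idx (g s) = idx s.
  move=> ag gt0; congr xget; apply/seteqP.
  have ord n := has_order_automorphism t0 s (e n) ag.
  by rewrite gt0 in ord; split=> n /ord.
have idx_surj n : exists s, idx s = n.
  have [x [[a [b [ab ->]]] /(has_ramification_orderE TC) ord]] :
    ramification_orders T (e n) by apply: funS.
  have [a' aa'] := bt_above bt a; have [t' tt'] := bt_above bt t0.
  have [g [ag ga _]] := bt_trans bt aa' tt'.
  exists (g b); have ngb : idx_set (g b) n.
    by rewrite /idx_set /= -ga; apply/has_order_automorphism.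
  rewrite /idx; case: xgetP => [m _ ngb'|/(_ n)//].
  have : e m = e n.
    by apply: (@has_ramification_order_uniq _ _ (tmeet t0 (g b)));
      apply/(has_ramification_orderE TC).
  by move=> /inj; apply; rewrite inE.
have sG := @automorphism_subgroup d T.
pose f := coll T (fun s => fm_opair (atom s) (fm_nat (A := T) (idx s))).
exists f; split.
  apply: (@fm_model_coll _ _ [set t0]) => // [g ag gt0|s].
    have {}gt0 := gt0 t0 erefl.
    have act s : fm_act g (fm_opair (atom s) (fm_nat (idx s))) =
        fm_opair (atom (g s)) (fm_nat (idx (g s))).
      by rewrite fm_act_opair fm_act_nat idx_inv.
    have [[h gK hK] _] := ag.
    split=> s; [exists (g s)|exists (h s)]; rewrite act ?hK; exact: fm_eq_refl.
  by apply: fm_model_opair => //; [exact: fm_model_atom|exact: fm_model_nat].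
split; first split=> //.
- move=> p [s ps]; exists (atom s), (fm_nat (idx s)); split=> //.
  + by exists s.
  + by exists (idx s); exact: fm_eq_refl.
- move=> x [s xs]; exists (fm_nat (idx s)); split.
    by exists s; apply: fm_opair_eq => //; exact: fm_eq_refl.
  move=> y [s' /fm_opair_inj[xs' ys']].
  by have <- : s' = s by exact: fm_eq_trans (fm_eq_sym xs') xs.
- move=> y [n yn]; have [s sn] := idx_surj n; exists (atom s); split; first by exists s.
  by exists s; rewrite sn; apply: fm_opair_eq => //; exact: fm_eq_refl.
Qed.

End Classes.

(** * First-order properties of two binary relations *)

Definition two_relations : language :=
  @Language void (of_void _) bool (fun _ => 2%N).

Definition relations {D} (S : structure two_relations D) (b : bool) (x y : D) : Prop :=
  @rel_interp two_relations D S b [tuple x; y].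

Definition structure_of {D} (r P : D -> D -> Prop) : structure two_relations D :=
  @Structure two_relations D (fun f => match f with end)
    (fun b s => (if b then r else P) (thead s) (tnth s (Ordinal (isT : (1 < 2)%N)))).

Definition FRel2 n (b : bool) (i j : 'I_n) : formula two_relations n :=
  @FRel two_relations n b (fun k => Var _ (if k == ord0 then i else j)).
Definition FNot L n (p : formula L n) : formula L n := FImp p (FFalse L n).
Definition FAnd L n (p q : formula L n) : formula L n := FNot (FImp p (FNot q)).
Definition FEx L n (p : formula L n.+1) : formula L n := FNot (FAll (FNot p)).

(** De Bruijn indices as lifts of [ord0], so that they compute in tuples. *)
Definition v0 n : 'I_n.+1 := ord0.
Definition v1 n : 'I_n.+2 := lift ord0 (v0 n).
Definition v2 n : 'I_n.+3 := lift ord0 (v1 n).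
Arguments v0 {n}.
Arguments v1 {n}.
Arguments v2 {n}.
Notation Le i j := (FRel2 true i j).

Section Satisfaction.
Context {L : language} {D : Type} (S : structure L D).

Lemma sat_imp n (p q : formula L n) e (P Q : Prop) :
  (sat S p e <-> P) -> (sat S q e <-> Q) -> (sat S (FImp p q) e <-> (P -> Q)).
Proof. by move=> /= -> ->. Qed.

Lemma sat_not n (p : formula L n) e (P : Prop) :
  (sat S p e <-> P) -> (sat S (FNot p) e <-> ~ P).
Proof. by move=> /= ->. Qed.

Lemma sat_and n (p q : formula L n) e (P Q : Prop) :
  (sat S p e <-> P) -> (sat S q e <-> Q) -> (sat S (FAnd p q) e <-> P /\ Q).
Proof.
move=> /= -> ->; split=> [h|[p1 q1]]; last by apply.
by apply: contrapT => n'; apply: h => p1 q1; apply: n'.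
Qed.

Lemma sat_iff n (p q : formula L n) e (P Q : Prop) :
  (sat S p e <-> P) -> (sat S q e <-> Q) ->
  (sat S (FAnd (FImp p q) (FImp q p)) e <-> (P <-> Q)).
Proof. by move=> hp hq; apply: sat_and; apply: sat_imp. Qed.

Lemma sat_all n (p : formula L n.+1) e (P : D -> Prop) :
  (forall x, sat S p (cons_tuple x e) <-> P x) ->
  (sat S (FAll p) e <-> forall x, P x).
Proof. by move=> h /=; split=> k x; apply/h. Qed.

Lemma sat_ex n (p : formula L n.+1) e (P : D -> Prop) :
  (forall x, sat S p (cons_tuple x e) <-> P x) ->
  (sat S (FEx p) e <-> exists x, P x).
Proof.
move=> h /=; split=> [k|[x /h Px]]; last by move=> /(_ x Px).
by apply: contrapT => n'; apply: k => x /h Px; apply: n'; exists x.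
Qed.

Lemma sat_var_eq n (i j : 'I_n) e :
  sat S (FEq (Var L i) (Var L j)) e <-> tnth e i = tnth e j.
Proof. by []. Qed.

End Satisfaction.

Lemma sat_rel2 D (S : structure two_relations D) n b (i j : 'I_n) e :
  sat S (FRel2 b i j) e <-> relations S b (tnth e i) (tnth e j).
Proof.
rewrite /relations /=; set t := [tuple _ | k < 2].
suff -> : t = [tuple tnth e i; tnth e j] by [].
by apply: eq_from_tnth => -[[|[|k]] lt] //; rewrite tnth_mktuple.
Qed.

(** Quantifying over all domains and structures makes [X] a property that passes
    between elementarily equivalent structures. *)
Definition first_order (X : forall D, (bool -> D -> D -> Prop) -> Prop) : Prop :=
  exists p : sentence two_relations,
    forall D (S : structure two_relations D), sat S p [tuple] <-> X D (relations S).

Lemma first_order_transfer X D1 D2 (S1 : structure two_relations D1)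
    (S2 : structure two_relations D2) :
  first_order X -> elementarily_equivalent S1 S2 ->
  X D1 (relations S1) -> X D2 (relations S2).
Proof. by move=> [p pX] eq12; rewrite -!pX; apply eq12. Qed.

(** Reads off a semantic statement from a formula, connective by connective. *)
Ltac fo :=
  repeat first
    [ apply: sat_all => ? | apply: sat_ex => ? | apply: sat_not | apply: sat_iff
    | apply: sat_and | apply: sat_imp
    | apply: (sat_rel2 _ _ _ _ _) | apply: (sat_var_eq _ _ _ _) ].

Lemma first_order_refl : first_order (fun D R => forall x, R true x x).
Proof. by exists (FAll (Le v0 v0)) => D S; fo. Qed.

Lemma first_order_tree : first_order (fun D R =>
  forall x y z, R true y x -> R true z x -> ~ R true y z -> R true z y).
Proof.
exists (FAll (FAll (FAll (FImp (Le v1 v2) (FImp (Le v0 v2)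
  (FImp (FNot (Le v1 v0)) (Le v0 v1))))))) => D S.
fo.
Qed.

Lemma first_order_fork : first_order (fun D R =>
  forall x y, R true x y -> x <> y ->
    exists z, R true x z /\ (~ R true z y /\ ~ R true y z)).
Proof.
exists (FAll (FAll (FImp (Le v1 v0) (FImp (FNot (FEq (Var _ v1) (Var _ v0)))
  (FEx (FAnd (Le v2 v0) (FAnd (FNot (Le v0 v1)) (FNot (Le v1 v0))))))))) => D S.
fo.
Qed.

Lemma first_order_separate : first_order (fun D R =>
  forall x y, ~ R true x y -> ~ R true y x ->
    exists z, R true z x /\ (z <> x /\ ~ R true z y)).
Proof.
exists (FAll (FAll (FImp (FNot (Le v1 v0)) (FImp (FNot (Le v0 v1))
  (FEx (FAnd (Le v0 v2) (FAnd (FNot (FEq (Var _ v0) (Var _ v2)))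
    (FNot (Le v0 v1))))))))) => D S.
fo.
Qed.

Lemma first_order_cofinal : first_order (fun D R =>
  forall a, exists x y, R true a x /\ (R true a y /\ R false x y)).
Proof.
exists (FAll (FEx (FEx (FAnd (Le v2 v1) (FAnd (Le v2 v0)
  (FRel2 false v1 v0)))))) => D S.
fo.
Qed.

Lemma first_order_incomparable : first_order (fun D R =>
  forall x y, R false x y -> ~ R true x y /\ ~ R true y x).
Proof.
exists (FAll (FAll (FImp (FRel2 false v1 v0)
  (FAnd (FNot (Le v1 v0)) (FNot (Le v0 v1)))))) => D S.
fo.
Qed.

Lemma first_order_all_meets : first_order (fun D R =>
  forall t, exists x y, R false x y /\ is_meet (R true) t x y).
Proof.
pose v3 := lift ord0 (@v2 0).
exists (FAll (FEx (FEx (FAnd (FRel2 false v1 v0)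
  (FAll (FAnd (FImp (Le v0 v3) (FAnd (Le v0 v2) (Le v0 v1)))
              (FImp (FAnd (Le v0 v2) (Le v0 v1)) (Le v0 v3)))))))) => D S.
rewrite /is_meet; fo.
Qed.

Lemma first_order_no_meets : first_order (fun D R =>
  forall t x y, is_meet (R true) t x y -> ~ R true x y -> R true y x).
Proof.
pose v3 := lift ord0 (@v2 0).
exists (FAll (FAll (FAll (FImp
  (FAll (FAnd (FImp (Le v0 v3) (FAnd (Le v0 v2) (Le v0 v1)))
              (FImp (FAnd (Le v0 v2) (Le v0 v1)) (Le v0 v3))))
  (FImp (FNot (Le v1 v0)) (Le v0 v1)))))) => D S.
rewrite /is_meet; fo.
Qed.

Definition shift n (i : 'I_n) : 'I_n.+1 := lift ord0 i.

Definition FAbove n (x y z : 'I_n) : formula two_relations n :=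
  FAnd (FAll (FImp (Le v0 (shift x)) (FImp (Le v0 (shift y)) (Le v0 (shift z)))))
       (FNot (FAnd (Le z x) (Le z y))).

Definition FSeparated n (x y z w : 'I_n) : formula two_relations n :=
  FAll (FImp (Le v0 (shift z)) (FImp (Le v0 (shift w))
    (FAnd (Le v0 (shift x)) (Le v0 (shift y))))).

Fixpoint FSeparatedFrom n (x y z : 'I_n) (l : seq 'I_n) : formula two_relations n :=
  if l is w :: l' then FAnd (FSeparated x y z w) (FSeparatedFrom x y z l')
  else FNot (FFalse _ n).

Fixpoint FConesGe k n (x y : 'I_n) (l : seq 'I_n) : formula two_relations n :=
  if k is k'.+1 then
    FEx (FAnd (FAbove (shift x) (shift y) v0)
         (FAnd (FSeparatedFrom (shift x) (shift y) v0 (map (@shift n) l))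
               (FConesGe k' (shift x) (shift y) (v0 :: map (@shift n) l))))
  else FNot (FFalse _ n).

Section ConesFormula.
Context {D : Type} (S : structure two_relations D).
Let R := relations S true.

Lemma sat_above n (x y z : 'I_n) e :
  sat S (FAbove x y z) e <-> above_meet R (tnth e x) (tnth e y) (tnth e z).
Proof.
apply: sat_and; last by fo.
by apply: sat_all => v; do 2?apply: sat_imp; rewrite sat_rel2 /shift ?tnthS tnth0.
Qed.

Lemma sat_separated n (x y z w : 'I_n) e :
  sat S (FSeparated x y z w) e <->
  cone_separated R (tnth e x) (tnth e y) (tnth e z) (tnth e w).
Proof.
apply: sat_all => v; do 2?apply: sat_imp; last apply: sat_and;
  by rewrite sat_rel2 /shift ?tnthS tnth0.
Qed.

Lemma sat_separated_from n (x y z : 'I_n) l e :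
  sat S (FSeparatedFrom x y z l) e <->
  separated_from R (tnth e x) (tnth e y) (tnth e z) (map (tnth e) l).
Proof.
elim: l => [|w l IH]; first by split=> // _ [].
exact: sat_and (sat_separated _ _ _ _ _) IH.
Qed.

Lemma sat_cones_ge k n (x y : 'I_n) l e :
  sat S (FConesGe k x y l) e <->
  cones_ge R (tnth e x) (tnth e y) k (map (tnth e) l).
Proof.
elim: k n x y l e => [|k IH] n x y l e; first by split=> // _ [].
apply: sat_ex => z.
have shiftE i : tnth (cons_tuple z e) (shift i) = tnth e i by rewrite /shift tnthS.
have mapE : map (tnth (cons_tuple z e)) (map (@shift n) l) = map (tnth e) l.
  by rewrite -map_comp; apply: eq_map => i /=.
have split3 (P Q U : Prop) : [/\ P, Q & U] <-> P /\ (Q /\ U).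
  by split=> [[]|[? []]].
rewrite split3 -!(shiftE x) -!(shiftE y) -mapE.
apply: sat_and; first exact: sat_above.
apply: sat_and; first exact: sat_separated_from.
exact: IH.
Qed.

End ConesFormula.

Lemma first_order_cones_ge k : first_order (fun D R =>
  forall x y, R false x y -> cones_ge (R true) x y k [::]).
Proof.
exists (FAll (FAll (FImp (FRel2 false v1 v0) (FConesGe k v1 v0 [::])))) => D S.
do 2!apply: sat_all => ?; apply: sat_imp; first by fo.
exact: sat_cones_ge.
Qed.

Lemma first_order_cones_lt k : first_order (fun D R =>
  forall x y, R false x y -> ~ cones_ge (R true) x y k [::]).
Proof.
exists (FAll (FAll (FImp (FRel2 false v1 v0) (FNot (FConesGe k v1 v0 [::]))))) => D S.
do 2!apply: sat_all => ?; apply: sat_imp; first by fo.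
by apply: sat_not; exact: sat_cones_ge.
Qed.

(** * Structures in the models and recovery of the code *)

Lemma fm_model_invariant_structure d (T : porderType d) (r P : T -> T -> Prop) :
  (forall g x y, is_automorphism g -> (r (g x) (g y) <-> r x y)) ->
  (forall g x y, is_automorphism g -> (P (g x) (g y) <-> P x y)) ->
  tree_model T (fm_structure (structure_of r P)).
Proof.
move=> r_inv P_inv; have sG := @automorphism_subgroup d T.
set S := structure_of r P.
have S_inv g b (s : 2.-tuple T) : is_automorphism g ->
    @rel_interp two_relations T S b (map_tuple g s) <-> @rel_interp two_relations T S b s.
  move=> ag; rewrite /= /thead !tnth_map.
  by case: b; [exact: r_inv|exact: P_inv].
have rel_act g b : is_automorphism g ->
    fm_eq (fm_act g (fm_relation (@rel_interp two_relations T S b)))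
          (fm_relation (@rel_interp two_relations T S b)).
  move=> ag; have [[h gK hK] _] := ag.
  have [_ _ _ inv] := sG; have ah := inv _ _ ag gK hK.
  split=> -[s Rs].
    by exists (exist _ (map_tuple g s) ((S_inv g b s ag).2 Rs));
      rewrite fm_act_tuple; exact: fm_eq_refl.
  exists (exist _ (map_tuple h s) ((S_inv h b s ah).2 Rs)).
  by rewrite fm_act_tuple /= mapK //; exact: fm_eq_refl.
apply: fm_model_opair => //; first exact: tree_model_atoms.
apply: fm_model_opair => //.
  by apply: (fm_model_coll sG (finite_set0 _)) => [g _ _|[]]; split=> -[].
apply: (fm_model_coll sG (finite_set0 _)) => [g ag _|b].
  by split=> b; exists b; rewrite fm_act_opair fm_act_nat;
    apply: fm_opair_eq; [exact: fm_eq_refl|exact: rel_act|exact: fm_eq_refl|exact: rel_act].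
apply: fm_model_opair => //; first exact: fm_model_nat.
apply: (fm_model_coll sG (finite_set0 _)) => [g ag _|s]; first exact: rel_act.
exact: fm_model_tuple.
Qed.

(** The model is transitive, so the interpretation of a single symbol has a
    finite support of its own. *)
Lemma fm_model_structure_support d (T : porderType d)
    (S : structure two_relations T) :
  tree_model T (fm_structure S) ->
  exists A : seq T, forall g, is_automorphism g -> {in A, forall a, g a = a} ->
    forall x y, relations S true x y -> relations S true (g x) (g y).
Proof.
move=> /fm_model_opair_snd/fm_model_opair_snd[_ /(_ true)].
move=> /fm_model_opair_snd/fm_model_supported[B /finite_set_mem[A AB] supp].
exists A => g ag gA x y Rxy.
have [|h _] := supp g ag; first by move=> a /AB; exact: gA.
have [[s Rs]] : exists s : {s : 2.-tuple T | @rel_interp two_relations T S true s},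
    fm_eq (fm_act g (fm_tuple [tuple x; y])) (fm_tuple (sval s)).
  exact: h (exist _ [tuple x; y] Rxy).
rewrite fm_act_tuple => eqs.
have e : [:: g x; g y] = s by apply: fm_tuple_inj eqs; exact: (esym (size_tuple s)).
by rewrite /relations; have -> : [tuple g x; g y] = s by exact: val_inj.
Qed.

Lemma incomparableP d (T : porderType d) (x y : T) : x >< y <-> ~ x <= y /\ ~ y <= x.
Proof.
rewrite /Order.comparable negb_or.
by split=> [/andP[/negP ? /negP ?]|[/negP ? /negP ?]]; last apply/andP.
Qed.

Lemma is_meetE d (T : porderType d) (t x y : T) :
  is_meet (fun x y => x <= y) t x y <-> tembed t = tmeet x y.
Proof.
split=> [m|e v].
  by apply/esym/tmeet_unique => v; apply/idP/andP; case: (m v).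
have ev : (v <= t /\ v <= t) = (v <= x /\ v <= y) := congr1 (fun X => lower X v) e.
by rewrite -ev; split=> [|[]].
Qed.

Section CodeTransfer.
Context {d1 d2 : Order.disp_t} {T1 : porderType d1} {T2 : porderType d2}.
Hypotheses (bt1 : branching_tree T1) (bt2 : branching_tree T2).
Hypothesis transfer : structures_transfer (tree_model T1) (tree_model T2).

Let le1 (x y : T1) : Prop := x <= y.
Let le2 (x y : T2) : Prop := x <= y.

(** The structure on [T1] consists of its order and of the relation [P] of having
    a meet with ramification order [o].  In the structure provided on [T2],
    pairs related by the counterpart [Q] of [P] are cofinal, so some lie in the
    region where the two orders agree, and there the cones of [r] are cones of
    [T2]. *)
Lemma ramification_order_transfer o : ramification_orders T1 o ->
  [/\ ramification_orders T2 o,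
      (forall t : T1, ramification_point (tembed t) /\
         has_ramification_order (tembed t) o) ->
      exists t : T2, ramification_point (tembed t) /\
         has_ramification_order (tembed t) o
    & (forall t : T2, ramification_point (tembed t)) ->
      exists t : T1, ramification_point (tembed t)].
Proof.
move=> [_ [[a0 [b0 [ab0 ->]]] /(has_ramification_orderE (bt_chain bt1)) ord0]].
pose P (x y : T1) := x >< y /\ has_order le1 x y o.
have P_inv g x y : is_automorphism g -> (P (g x) (g y) <-> P x y).
  move=> ag; have [_ mg] := ag.
  by rewrite /P /Order.comparable !mg (has_order_automorphism _ _ _ ag).
have NS : tree_model T1 (fm_structure (structure_of le1 P)).
  apply: fm_model_invariant_structure => // g x y [_ mg].
  by rewrite /le1 mg.
have [S [NS2 eqS]] := transfer NS.
pose r := relations S true; pose Q := relations S false.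
have tr X := fun foX : first_order X => first_order_transfer foX eqS.
have r_refl : forall x, r x x by apply: (tr _ first_order_refl) => x; exact: lexx.
have r_tree x y z : r y x -> r z x -> r y z \/ r z y.
  move=> ryx rzx; case: (pselect (r y z)) => nyz; [by left|right].
  apply: (tr _ first_order_tree) ryx rzx nyz => {}x {}y {}z yx zx nyz.
  by case/orP: (bt_chain bt1 yx zx).
have r_fork x y : r x y -> x <> y -> exists z, [/\ r x z, ~ r z y & ~ r y z].
  move=> rxy nxy; have [|z [xz [zy yz]]] := tr _ first_order_fork _ x y rxy nxy.
    move=> {r_refl r_tree} v w vw nvw.
    have /(bt_fork bt1)[z [vz zw]] : (v : T1) < w.
      by rewrite lt_neqAle [v <= w]vw andbT; apply/eqP.
    by exists z; split; [exact: ltW|exact/incomparableP].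
  by exists z.
have r_separate x y : ~ r x y -> ~ r y x -> exists z, [/\ r z x, z <> x & ~ r z y].
  move=> nxy nyx; have [|z [zx [nzx nzy]]] := tr _ first_order_separate _ x y nxy nyx.
    move=> v w nvw nwv; have /(bt_separate bt1)[z [zv nzw]] : (v : T1) >< w.
      exact/incomparableP.
    exists z; split; first exact: ltW.
    by split; [move=> e; rewrite e ltxx in zv|exact/negP].
  by exists z.
have [A r_inv] := fm_model_structure_support NS2.
(* The first-order properties of r established so far determine it above u. *)
have [u [ins ins2 agree]] :=
  invariant_tree_order_agrees bt2 r_inv r_refl r_tree r_fork r_separate.
have agree2 x y : u < x -> u < y -> (le2 x y <-> r x y).
  by move=> ux uy; exact: iff_sym (agree x y ux uy).
have above x y : u < x -> r x y -> u < y.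
  by move=> ux rxy; apply: contrapT => nuy; case: ins => _ /(_ y x nuy ux).
have Q_order x y : Q x y -> has_order r x y o.
  have ge k : (forall v w, P v w -> cones_ge le1 v w k [::]) ->
    forall v w, Q v w -> cones_ge r v w k [::] := tr _ (first_order_cones_ge k).
  have lt k : (forall v w, P v w -> ~ cones_ge le1 v w k [::]) ->
    forall v w, Q v w -> ~ cones_ge r v w k [::] := tr _ (first_order_cones_lt k).
  have ordP v w : P v w -> has_order le1 v w o by case.
  move=> Qxy; case eo: o => [n|]; rewrite eo in ordP.
    by split; [apply: ge Qxy => v w /ordP[]|apply: lt Qxy => v w /ordP[]].
  by move=> n; apply: ge Qxy => v w /ordP.
have Q_inc x y : Q x y -> ~ r x y /\ ~ r y x.
  by apply: (tr _ first_order_incomparable) => v w [/incomparableP].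
have ramified a x y : u < a -> r a x -> r a y -> Q x y ->
    x >< y /\ has_ramification_order (tmeet x y) o.
  move=> ua ax ay Qxy; have ux := above _ _ ua ax; have uy := above _ _ ua ay.
  split.
    apply/incomparableP; rewrite -/(le2 x y) -/(le2 y x) !agree2 //.
    exact: Q_inc.
  apply/(has_ramification_orderE (bt_chain bt2)).
  have Ra (v : T2) i : u < nth a [::] i by rewrite nth_nil.
  have cones k : cones_ge r x y k [::] <-> cones_ge le2 x y k [::].
    split; first exact: cones_ge_insulated ins ins2 agree ua ux uy ax ay (Ra a).
    apply: (cones_ge_insulated ins2 ins agree2 ua ux uy _ _ (Ra a));
      by apply/agree2.
  have := Q_order x y Qxy; rewrite /has_order; case: (o) => [n|]; first by rewrite !cones.
  by move=> h n; apply/cones.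
have [a ua] := bt_above bt2 u.
split.
- have [|x [y [ax [ay Qxy]]]] := tr _ first_order_cofinal _ a.
    move=> {ua}a; have [v [va vb]] := bt_lower bt1 a0 b0.
    have {}va : v < a0.
      rewrite lt_neqAle va andbT; apply: contraTneq vb => ->.
      by move/incomparableP: ab0 => [/negP].
    have [c ac] := bt_above bt1 a; have [g [ag gv _]] := bt_trans bt1 va ac.
    have [_ mg] := ag; exists (g a0), (g b0).
    have Pg : P (g a0) (g b0) by apply/P_inv.
    have ga : a <= g a0 by rewrite -gv mg ltW.
    by have gb : a <= g b0 by rewrite -gv mg.
  have [xy ord] := ramified a x y ua ax ay Qxy.
  by exists (tmeet x y); split=> //; exists x, y.
- move=> all1; have [|x [y [Qxy m]]] := tr _ first_order_all_meets _ a.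
    move=> t; have [[x [y [xy e]]] ord] := all1 t; exists x, y; split.
      by split=> //; apply/(has_ramification_orderE (bt_chain bt1)); rewrite -e.
    exact/is_meetE.
  have [ax ay] := (m a).1 (r_refl a).
  have [xy ord] := ramified a x y ua ax ay Qxy.
  have e : tembed a = tmeet x y.
    apply/is_meetE; apply: (is_meet_insulated ins ins2 agree ua _ _ m).
      exact: above ua ax.
    exact: above ua ay.
  by exists a; rewrite e; split=> //; exists x, y.
- move=> all2; apply: contrapT => none.
  have [x [y [xy e]]] := all2 a.
  have /is_meetE m := e.
  have [ax ay] := (m a).1 (lexx a).
  have ux := lt_le_trans ua ax; have uy := lt_le_trans ua ay.
  move: xy => /incomparableP; rewrite -/(le2 x y) -/(le2 y x) !agree2 // => -[nxy]; apply.
  apply: (tr _ first_order_no_meets) nxy.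
    move=> t v w /is_meetE et nvw; apply: contrapT => nwv; apply: none.
    by exists t, v, w; split=> //; exact/incomparableP.
  exact: is_meet_insulated ins2 ins agree2 ua ux uy m.
Qed.
Lemma points_ramification_order_transfer o1 o2 :
  ramification_orders T1 !=set0 ->
  points_ramification_order T1 o1 -> points_ramification_order T2 o2 -> o1 = o2.
Proof.
move=> [o To] [[-> none1]|all1] [[-> none2]|all2] //.
- have [_ _] := ramification_order_transfer To.
  case; first by move=> t; have [] := all2 t.
  by move=> t /none1.
- have [t0 _] := bt_branch bt1.
  have [|_ /(_ all1)[t [rt _]] _] := @ramification_order_transfer o1.
    by exists (tembed t0).
  by case: (none2 t).
- have [t0 _] := bt_branch bt1.
  have [|_ /(_ all1)[t [_ o1t]] _] := @ramification_order_transfer o1.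
    by exists (tembed t0).
  exact: has_ramification_order_uniq o1t (all2 t).2.
Qed.

End CodeTransfer.

Theorem theorem3p2 (d1 d2 : Order.disp_t)
    (T1 : porderType d1) (T2 : porderType d2) (c1 c2 : tree_code)
    (T1_tree : is_tree T1) (T2_tree : is_tree T2)
    (T1_countable : countable (@setT T1)) (T2_countable : countable (@setT T2))
    (T1_trans : weakly_2_transitive T1) (T2_trans : weakly_2_transitive T2)
    (T1_nontrivial : nontrivial_tree T1) (T2_nontrivial : nontrivial_tree T2)
    (T1_dense : maximal_chains_dense (tplus T1))
    (T2_dense : maximal_chains_dense (tplus T2))
    (T1_code : is_code T1 c1) (T2_code : is_code T2 c2)
    (c1_infinite : infinite_code c1) (c2_infinite : infinite_code c2)
    (c1_neq_c2 : c1 <> c2) :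
  (Delta5 (tree_model T1) (fm_atoms T1) /\
   ~ Delta4 (tree_model T1) (fm_atoms T1)) /\
  (Delta5 (tree_model T2) (fm_atoms T2) /\
   ~ Delta4 (tree_model T2) (fm_atoms T2)) /\
  ~ atoms_equivalent (tree_model T1) (tree_model T2).
Proof.
have bt1 := branching_treeP T1_tree T1_trans T1_nontrivial T1_dense.
have bt2 := branching_treeP T2_tree T2_trans T2_nontrivial T2_dense.
have [e1 p1] := T1_code; have [e2 p2] := T2_code.
rewrite /infinite_code e1 in c1_infinite; rewrite /infinite_code e2 in c2_infinite.
split; first by split; [exact: Delta5_atoms|exact: not_Delta4_atoms].
split; first by split; [exact: Delta5_atoms|exact: not_Delta4_atoms].
move=> [tr12 tr21]; apply: c1_neq_c2.
rewrite [c1]surjective_pairing [c2]surjective_pairing; congr pair.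
  rewrite e1 e2; apply/seteqP; split=> o.
    by case/(ramification_order_transfer bt1 bt2 tr12).
  by case/(ramification_order_transfer bt2 bt1 tr21).
exact: (points_ramification_order_transfer bt1 bt2 tr12 (infinite_setN0 c1_infinite) p1 p2).
Qed.
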